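(* A graph $G$ of order $2n$ is degree-equipartite if and only if it is (isomorphic to) one of the following graphs: $$2nK_1,\quad nK_2,\quad 2C_4,\quad K_{n,n}\setminus nK_2,\quad 2K_n,$$ or one of their complements $$K_{2n},\quad K_{2n}\setminus nK_2,\quad K_8\setminus 2C_4,\quad 2K_n+nK_2,\quad K_{n,n}.$$
   Context: All graphs are finite and simple (no loops, no multiple edges). The order of a graph $G$ is its number of vertices; $V(G)$ is its vertex set; for $A\subseteq V(G)$, $G[A]$ denotes the subgraph of $G$ induced by $A$. The degree sequence of a graph is the multiset of degrees of its vertices (equivalently, the degrees listed in sorted order). A graph $G$ of order $2n$ is called degree-equipartite if for every $n$-element set $A\subseteq V(G)$, the degree sequences of the induced subgraphs $G[A]$ and $G[V(G)\setminus A]$ are the same. Notation: $K_m$ is the complete graph on $m$ vertices, $K_{n,n}$ the complete bipartite graph with both parts of size $n$, $C_4$ the cycle on 4 vertices, and $mH$ the disjoint union of $m$ copies of $H$. Thus $2nK_1$ is the edgeless graph on $2n$ vertices and $nK_2$ is the 1-regular graph on $2n$ vertices. The graphs $2C_4$ and $K_8\setminus 2C_4$ have order 8, so they occur only for $n=4$. $K_{n,n}\setminus nK_2$ (respectively $K_{2n}\setminus nK_2$) is the graph obtained from $K_{n,n}$ (respectively $K_{2n}$) by deleting the edges of a perfect matching. $K_8\setminus 2C_4$ is the graph obtained from $K_8$ by deleting the edges of two vertex-disjoint 4-cycles, i.e. the complement of $2C_4$. $2K_n+nK_2$ is the graph obtained from two disjoint copies of $K_n$ by adding the $n$ edges of a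 perfect matching between the two copies, i.e. the complement of $K_{n,n}\setminus nK_2$. *)

(* Defs.v *)
From mathcomp Require Import all_boot.

Set Implicit Arguments.
Unset Strict Implicit.
Unset Printing Implicit Defensive.

Record sgraph := SGraph {
  vertex :> finType;
  adj : rel vertex;
  adj_sym : symmetric adj;
  adj_irrefl : irreflexive adj
}.

Definition isomorphic (G H : sgraph) : Prop :=
  exists2 f : G -> H,
    bijective f & forall x y : G, adj (f x) (f y) = adj x y.

Definition deg (G : sgraph) (x : G) : nat := #|[set y : G | adj x y]|.

Definition degree_sequence (G : sgraph) : seq nat :=
  sort geq [seq deg x | x : G].

Section Induced.
Variables (G : sgraph) (A : {set G}).

Definition induced_adj : rel {x : G | x \in A} :=
  fun x y => adj (val x) (val y).

Lemma induced_sym : symmetric induced_adj.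
Proof. by move=> x y; exact: adj_sym. Qed.

Lemma induced_irrefl : irreflexive induced_adj.
Proof. by move=> x; exact: adj_irrefl. Qed.

Definition induced : sgraph := SGraph induced_sym induced_irrefl.

End Induced.

(* Only meaningful for G of order 2 * n. *)
Definition degree_equipartite (n : nat) (G : sgraph) : Prop :=
  forall A : {set G}, #|A| = n ->
    degree_sequence (induced A) = degree_sequence (induced (~: A)).

Section Complete.
Variable V : finType.

Definition complete_adj : rel V := fun x y => x != y.

Lemma complete_sym : symmetric complete_adj.
Proof. by move=> x y; rewrite /complete_adj eq_sym. Qed.

Lemma complete_irrefl : irreflexive complete_adj.
Proof. by move=> x; rewrite /complete_adj eqxx. Qed.

Definition complete_on : sgraph := SGraph complete_sym complete_irrefl.

End Complete.

Definition K (m : nat) : sgraph := complete_on 'I_m.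

Section Cycle4.

Definition C4_adj : rel 'I_4 := fun x y => (y == ordS x) || (x == ordS y).

Lemma C4_sym : symmetric C4_adj.
Proof. by move=> x y; rewrite /C4_adj orbC. Qed.

Lemma C4_irrefl : irreflexive C4_adj.
Proof. by case=> [[|[|[|[|]]]]]. Qed.

Definition C4 : sgraph := SGraph C4_sym C4_irrefl.

End Cycle4.

(* The disjoint union mH; vertex (i, x) is the vertex x of the i-th copy. *)
Section Copies.
Variables (m : nat) (H : sgraph).

Definition copies_adj : rel ('I_m * H)%type :=
  fun u v => (u.1 == v.1) && adj u.2 v.2.

Lemma copies_sym : symmetric copies_adj.
Proof. by move=> u v; rewrite /copies_adj eq_sym adj_sym. Qed.

Lemma copies_irrefl : irreflexive copies_adj.
Proof. by move=> u; rewrite /copies_adj adj_irrefl andbF. Qed.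

Definition copies : sgraph := SGraph copies_sym copies_irrefl.

End Copies.

(* Graphs on 'I_2 * 'I_n, the two sides being distinguished by the first
   coordinate. *)
Section TwoSides.
Variable n : nat.

Definition Knn_adj : rel ('I_2 * 'I_n)%type := fun u v => u.1 != v.1.

Lemma Knn_sym : symmetric Knn_adj.
Proof. by move=> u v; rewrite /Knn_adj eq_sym. Qed.

Lemma Knn_irrefl : irreflexive Knn_adj.
Proof. by move=> u; rewrite /Knn_adj eqxx. Qed.

Definition Knn : sgraph := SGraph Knn_sym Knn_irrefl.

Definition matching_adj : rel ('I_2 * 'I_n)%type :=
  fun u v => (u.1 != v.1) && (u.2 == v.2).

Lemma matching_sym : symmetric matching_adj.
Proof. by move=> u v; rewrite /matching_adj !(eq_sym u.1, eq_sym u.2). Qed.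

Lemma matching_irrefl : irreflexive matching_adj.
Proof. by move=> u; rewrite /matching_adj eqxx. Qed.

Definition matching : sgraph := SGraph matching_sym matching_irrefl.

End TwoSides.

Section EdgeOperations.
Variable G : sgraph.

Section Binary.
Variables (e : rel G) (e_sym : symmetric e) (e_irrefl : irreflexive e).

Definition del_adj : rel G := fun x y => adj x y && ~~ e x y.

Lemma del_sym : symmetric del_adj.
Proof. by move=> x y; rewrite /del_adj adj_sym e_sym. Qed.

Lemma del_irrefl : irreflexive del_adj.
Proof. by move=> x; rewrite /del_adj adj_irrefl. Qed.

Definition del_edges : sgraph := SGraph del_sym del_irrefl.

Definition add_adj : rel G := fun x y => adj x y || e x y.

Lemma add_sym : symmetric add_adj.
Proof. by move=> x y; rewrite /add_adj adj_sym e_sym. Qed.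

Lemma add_irrefl : irreflexive add_adj.
Proof. by move=> x; rewrite /add_adj adj_irrefl e_irrefl. Qed.

Definition add_edges : sgraph := SGraph add_sym add_irrefl.

End Binary.

Definition compl_adj : rel G := fun x y => (x != y) && ~~ adj x y.

Lemma compl_sym : symmetric compl_adj.
Proof. by move=> x y; rewrite /compl_adj eq_sym adj_sym. Qed.

Lemma compl_irrefl : irreflexive compl_adj.
Proof. by move=> x; rewrite /compl_adj eqxx. Qed.

Definition compl : sgraph := SGraph compl_sym compl_irrefl.

End EdgeOperations.

Definition empty_graph (n : nat) : sgraph := copies (2 * n) (K 1).
Definition nK2 (n : nat) : sgraph := copies n (K 2).
Definition two_C4 : sgraph := copies 2 C4.
Definition Knn_minus_nK2 (n : nat) : sgraph :=
  @del_edges (Knn n) _ (@matching_sym n).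
Definition two_Kn (n : nat) : sgraph := copies 2 (K n).

Definition K2n (n : nat) : sgraph := K (2 * n).
(* The deleted perfect matching (resp. pair of 4-cycles) lives on the vertex
   type of nK2 n (resp. two_C4), so the complete graph is taken on that type
   rather than on 'I_(2 * n) (resp. 'I_8). *)
Definition K2n_minus_nK2 (n : nat) : sgraph :=
  @del_edges (complete_on (nK2 n)) _ (@adj_sym (nK2 n)).
Definition K8_minus_2C4 : sgraph :=
  @del_edges (complete_on two_C4) _ (@adj_sym two_C4).
Definition two_Kn_plus_nK2 (n : nat) : sgraph :=
  @add_edges (two_Kn n) _ (@matching_sym n) (@matching_irrefl n).

(* The second group of five graphs consists of the complements of the first
   group, in the same order. *)
Lemma compl_empty_graph n : isomorphic (compl (empty_graph n)) (K2n n).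
Proof.
exists fst.
  by exists (fun i => (i, ord0)) => [[i j]|i] //=; rewrite (ord1 j).
move=> [i a] [j b]; rewrite (ord1 a) (ord1 b) /= /complete_adj /compl_adj.
by rewrite xpair_eqE /= /copies_adj /= /complete_adj eqxx !andbT andbF andbT.
Qed.

Lemma compl_nK2 n : isomorphic (compl (nK2 n)) (K2n_minus_nK2 n).
Proof. by exists id => //; exists id. Qed.

Lemma compl_two_C4 : isomorphic (compl two_C4) K8_minus_2C4.
Proof. by exists id => //; exists id. Qed.

Lemma compl_Knn_minus_nK2 n :
  isomorphic (compl (Knn_minus_nK2 n)) (two_Kn_plus_nK2 n).
Proof.
exists id; first by exists id.
move=> [i a] [j b]; rewrite /= /add_adj /compl_adj /= /copies_adj /del_adj /=.
rewrite /Knn_adj /matching_adj /complete_adj xpair_eqE /=.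
by case: (i == j); case: (a == b).
Qed.

Lemma compl_two_Kn n : isomorphic (compl (two_Kn n)) (Knn n).
Proof.
exists id; first by exists id.
move=> [i a] [j b]; rewrite /= /compl_adj /= /copies_adj /=.
rewrite /Knn_adj /complete_adj xpair_eqE /=.
by case: (i == j); case: (a == b).
Qed.

(* Main.v *)
(* Counting edges shows that a degree-equipartite graph G is regular. Comparing
   the sums of the squared degrees shows that a cubic form in the signs +1/-1 of
   the two sides vanishes on all balanced signs; polarising it, the indicator m
   of monochromatic triples (triangles or independent triples) satisfies
     m(ace) - m(ade) - m(bce) + m(bde) does not depend on e.
   If C(xy) is the number of monochromatic triples through x and y, it follows
   that C(xy) + C(xz) + C(yz) - (2n - 4) m(xyz) is constant. Hence all values of
   C are congruent modulo n - 2, and for n >= 4 writing C = c0 + (n - 2) t gives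
   t in {0, 1, 2} unless G is complete or empty, with
     t(xy) + t(xz) + t(yz) = k + 2 m(xyz).
   Modulo 2 this makes t - k a cut, so the vertices split into two sides, and a
   short case analysis finds G; for n = 3 a monochromatic triple and its
   complement, then of the same color, play the role of the cut. Conversely, in
   the graphs of the list other than 2C_4 and its complement the degree of x in
   G[A] only depends on the number of vertices of A on each of two sides and on
   whether the partner of x is in A. *)

Require Import Defs.
From mathcomp Require Import all_boot all_order all_algebra zify ring.

Set Implicit Arguments.
Unset Strict Implicit.
Unset Printing Implicit Defensive.

(** * Degree sequences, isomorphism and complements *)

(** For [n >= 4] only the first two moments of the degree sequences are used: the test [F d = d]
    gives regularity, and [F d = d ^ 2] gives the cubic form, whose coefficients count cherries,
    that is, paths with two edges. Cherries are not symmetric between a graph and its complement.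
    Monochromatic triples are, and their indicator has the same third differences, which is why the
    proof passes to them. The threshold [n >= 4] comes from the range of the weights: unless [G] is
    complete or empty, [C(xy) <= 2n - 3], and [3(n - 2) > 2n - 3] holds exactly for [n >= 4]. At
    [n = 3] this bound would still allow the weight 3, hence the separate argument there. *)

Definition deg_in (G : sgraph) (A : {set G}) (x : G) : nat :=
  #|[set y in A | adj x y]|.

Lemma deg_induced (G : sgraph) (A : {set G}) (x : induced A) :
  deg x = deg_in A (val x).
Proof.
rewrite /deg /deg_in -(card_imset _ val_inj).
apply: eq_card => y; rewrite !inE; apply/imsetP/andP.
  by case=> z; rewrite inE => xz ->; split=> //; apply: valP.
by case=> yA xy; exists (Sub y yA); rewrite ?inE ?SubK.
Qed.

Lemma degree_sequence_induced (G : sgraph) (A : {set G}) :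
  degree_sequence (induced A) = sort geq [seq deg_in A x | x in A].
Proof.
have geq_total : total geq by move=> a b; apply: leq_total.
have geq_trans : transitive geq by move=> a b c ba ac; apply: leq_trans ac ba.
have geq_anti : antisymmetric geq.
  by move=> a b; rewrite /geq /= andbC => /anti_leq.
apply/(perm_sortP geq_total geq_trans geq_anti).
rewrite /image_mem (eq_map (@deg_induced G A)) (map_comp (deg_in A) val).
apply: perm_map; apply: uniq_perm.
- by rewrite map_inj_uniq ?enum_uniq //; apply: val_inj.
- exact: enum_uniq.
move=> x; rewrite mem_enum; apply/mapP/idP => [[y _ ->]|xA]; first exact: valP.
by exists (Sub x xA); rewrite ?mem_enum ?SubK.
Qed.

(** Finite multisets agree as soon as every function has the same sum over both; for the converse,
    indicators of predicates suffice. The classification tests with [d], [d ^ 2] and one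
    indicator. *)
Lemma degree_equipartiteP n (G : sgraph) :
  degree_equipartite n G <->
  (forall A : {set G}, #|A| = n -> forall F : nat -> nat,
     \sum_(x in A) F (deg_in A x) = \sum_(x in ~: A) F (deg_in (~: A) x)).
Proof.
have geq_total : total geq by move=> a b; apply: leq_total.
have geq_trans : transitive geq by move=> a b c ba ac; apply: leq_trans ac ba.
have geq_anti : antisymmetric geq.
  by move=> a b; rewrite /geq /= andbC => /anti_leq.
split=> H A cA.
  move=> F; have := H A cA; rewrite !degree_sequence_induced.
  move/(perm_sortP geq_total geq_trans geq_anti)=> P.
  rewrite -!big_enum /=.
  have : \sum_(d <- [seq deg_in A x | x in A]) F d =
      \sum_(d <- [seq deg_in (~: A) x | x in ~: A]) F d by apply: perm_big.
  by rewrite /image_mem !big_map.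
rewrite !degree_sequence_induced.
apply/(perm_sortP geq_total geq_trans geq_anti)/permP => p.
rewrite /image_mem !count_map -!sum1_count !(big_mkcond (preim _ _)) /=.
by rewrite !big_enum /= (H A cA (fun d => if p d then 1 else 0)).
Qed.

(** Within an [n]-set an induced degree [d] becomes [n - 1 - d], so testing [G] with [F (n - 1 - d)]
    amounts to testing its complement with [F]. *)
Lemma degree_equipartite_compl n (G : sgraph) (orderG : #|G| = 2 * n) :
  degree_equipartite n G -> degree_equipartite n (compl G).
Proof.
move=> /degree_equipartiteP H; apply/degree_equipartiteP => A cA F.
have deg_compl (B : {set G}) x : #|B| = n -> x \in B ->
    @deg_in (compl G) B x = n - 1 - deg_in B x.
  move=> cB xB; rewrite /deg_in.
  have -> : n = #|B :\ x|.+1 by rewrite -cB (cardsD1 x B) xB.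
  rewrite subn1 /= -(cardsID [set y | adj x y] (B :\ x)).
  have -> : #|(B :\ x) :&: [set y | adj x y]| = #|[set y in B | adj x y]|.
    apply: eq_card => y; rewrite !inE.
    by case: eqVneq => [->|_]; rewrite ?adj_irrefl ?andbF.
  rewrite addKn; apply: eq_card => y; rewrite !inE /= /compl_adj (eq_sym x).
  by case: (y \in B); case: (y == x); case: (adj x y).
have cCA : #|~: A| = n by have := cardsC A; rewrite cA orderG; lia.
have := H A cA (fun d => F (n - 1 - d)).
under eq_bigr => x xA do rewrite -(deg_compl A x cA xA).
by under [X in _ = X -> _]eq_bigr => x xA do rewrite -(deg_compl _ x cCA xA).
Qed.

Lemma isomorphic_sym G H : isomorphic G H -> isomorphic H G.
Proof.
case=> f [g fK gK] fadj; exists g; first by exists f.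
by move=> x y; rewrite -fadj !gK.
Qed.

Lemma isomorphic_trans G H I :
  isomorphic G H -> isomorphic H I -> isomorphic G I.
Proof.
case=> f bf fadj [g bg gadj]; exists (g \o f); first exact: bij_comp.
by move=> x y; rewrite /= gadj fadj.
Qed.

Lemma isomorphic_compl G H :
  isomorphic G H -> isomorphic (compl G) (compl H).
Proof.
case=> f bf fadj; exists f => // x y.
by rewrite /= /compl_adj fadj (inj_eq (bij_inj bf)).
Qed.

Lemma compl_compl G : isomorphic G (compl (compl G)).
Proof.
exists id => [|x y]; first by exists id.
by rewrite /= /compl_adj /= /compl_adj; case: eqVneq => [->|_];
  rewrite ?adj_irrefl ?negbK.
Qed.

Lemma degree_equipartite_iso n G H :
  isomorphic G H -> degree_equipartite n G -> degree_equipartite n H.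
Proof.
case=> f bf fadj /degree_equipartiteP eG.
have fI := bij_inj bf; apply/degree_equipartiteP => A cA F.
have deg_f (B : {set H}) x : deg_in (f @^-1: B) x = deg_in B (f x).
  rewrite /deg_in; have -> : [set y in f @^-1: B | adj x y] =
      f @^-1: [set y in B | adj (f x) y] by apply/setP => y; rewrite !inE fadj.
  by apply: on_card_preimset; apply: onW_bij.
have := eG (f @^-1: A); rewrite on_card_preimset; last exact: onW_bij.
move=> /(_ cA F); rewrite -preimsetC.
have sum_f (B : {set H}) : \sum_(x in f @^-1: B) F (deg_in (f @^-1: B) x) =
    \sum_(y in B) F (deg_in B y).
  rewrite [RHS](reindex f) /=; last exact: onW_bij.
  by apply: eq_big => x; rewrite ?inE // deg_f.
by rewrite !sum_f.
Qed.

(** * Balanced signs and monochromatic triples *)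

Section BalancedSigns.
Import GRing.Theory.
Local Open Scope ring_scope.

Lemma balanced_signs (V : finType) (X : {set V}) : ~~ odd #|X| ->
  exists2 s : V -> int, \sum_x s x = 0 &
    forall x, if x \in X then s x = 1 \/ s x = -1 else s x = 0.
Proof.
move=> evenX; pose k := #|X|./2; pose Y := [set x in take k (enum X)].
have sYX : Y \subset X.
  by apply/subsetP => x; rewrite inE => /mem_take; rewrite mem_enum.
have cY : #|Y| = k.
  rewrite cardsE (card_uniqP _) ?take_uniq ?enum_uniq // size_take -cardE.
  by rewrite /k; case: ltnP => //; lia.
exists (fun x => (x \in Y)%:R - (x \in X :\: Y)%:R).
  rewrite sumrB -!natr_sum -!big_mkcond !sum1_card cardsDS // cY.
  rewrite /k; lia.
move=> x; rewrite !inE; have := subsetP sYX x; rewrite inE.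
by case: (x \in take _ _) => [/(_ isT) ->|_]; case: (x \in X) => //=; lia.
Qed.

(** Its sum is zero: signs that are balanced off [a] and [b] stay balanced when [+1] or [-1] times
    it is added. All variations of signs below are of this kind. *)
Definition dipole (V : finType) (a b x : V) : int :=
  (x == a)%:R - (x == b)%:R.

Lemma sum_dipole (V : finType) (a b : V) (F : V -> int) :
  \sum_x F x * dipole a b x = F a - F b.
Proof.
have point c : \sum_x F x * (x == c)%:R = F c.
  rewrite (bigD1 c) //= eqxx mulr1 big1 ?addr0 // => x /negPf ->.
  by rewrite mulr0.
by rewrite -(point a) -(point b) -sumrB; apply: eq_bigr => x _; rewrite mulrBr.
Qed.

Section Signs.
Variables (n : nat) (G : sgraph).
Hypotheses (orderG : #|G| = (2 * n)%N) (equiG : degree_equipartite n G).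

Definition adjz (x y : G) : int := (adj x y)%:R.

Lemma adjzC x y : adjz x y = adjz y x.
Proof. by rewrite /adjz adj_sym. Qed.

Lemma adjzxx x : adjz x x = 0.
Proof. by rewrite /adjz adj_irrefl. Qed.

Lemma sum_adjz x : \sum_y adjz x y = (deg x)%:R.
Proof. by rewrite -natr_sum -big_mkcond /= sum1_card /deg cardsE. Qed.

Definition is_sign (s : G -> int) : Prop :=
  (forall x, s x = 1 \/ s x = -1) /\ \sum_x s x = 0.

Definition nbr_sum (s : G -> int) (x : G) : int := \sum_y adjz x y * s y.

Lemma sum_nbr_sum s : \sum_x nbr_sum s x = \sum_x s x * (deg x)%:R.
Proof.
rewrite exchange_big /=; apply: eq_bigr => y _; rewrite -mulr_suml mulrC.
by rewrite -sum_adjz; congr (_ * _); apply: eq_bigr => x _; rewrite adjzC.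
Qed.

(* The set [s = 1] has [n] elements, and [2 * d_x = deg x + s x * nbr_sum s x]
   where [d_x] is the degree of [x] within its own side. *)
Lemma sum_sign s : is_sign s -> forall F : nat -> nat,
  exists d : G -> nat,
    (forall x, 2 * (d x)%:R = (deg x)%:R + s x * nbr_sum s x) /\
    \sum_x s x * (F (d x))%:R = 0.
Proof.
case=> s1 s0 F; pose A := [set x | s x == 1].
have sA x : s x = (x \in A)%:R - (x \in ~: A)%:R.
  by rewrite !inE; case: (s1 x) => ->.
have cA : #|A| = n.
  move: s0; under eq_bigr => x _ do rewrite sA.
  rewrite sumrB -!natr_sum -!big_mkcond !sum1_card.
  by have := cardsC A; rewrite orderG; lia.
exists (fun x => if x \in A then deg_in A x else deg_in (~: A) x).
split=> [x|].
  rewrite /nbr_sum -sum_adjz mulr_sumr -big_split /=.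
  have -> : (if x \in A then deg_in A x else deg_in (~: A) x) =
            #|[set y | (s y == s x) && adj x y]|.
    case: ifP => xA; apply: eq_card => y; rewrite !inE.
      by move: xA; rewrite inE => /eqP ->.
    move: xA; rewrite inE; case: (s1 x) => -> //= _.
    by case: (s1 y) => ->.
  rewrite -sum1_card big_mkcond natr_sum mulr_sumr; apply: eq_bigr => y _.
  rewrite inE /adjz; case: (s1 x) => ->; case: (s1 y) => -> /=;
    by case: adj.
have := (degree_equipartiteP n G).1 equiG A cA F.
rewrite big_mkcond [RHS]big_mkcond /= => E.
have castF (B : {set G}) :
    \sum_x (x \in B)%:R * (F (deg_in B x))%:R =
    (\sum_x if x \in B then F (deg_in B x) else 0)%N%:R :> int.
  rewrite natr_sum; apply: eq_bigr => x _.
  by case: ifP; rewrite ?mul1r ?mul0r.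
rewrite (eq_bigr (fun x => (x \in A)%:R * (F (deg_in A x))%:R -
   (x \in ~: A)%:R * (F (deg_in (~: A) x))%:R)); first last.
  move=> x _; rewrite sA in_setC; case: (x \in A);
    by rewrite /= ?subr0 ?sub0r ?mul1r ?mul0r ?subr0 ?sub0r ?mulN1r.
by rewrite sumrB !castF E subrr.
Qed.

(** Take [F d = d]. As [s x * s x = 1], twice the vanishing sum splits into the sum of [s x * deg x]
    and that of [nbr_sum s x], which are equal by the symmetry of adjacency. *)
Lemma sum_sign_deg s : is_sign s -> \sum_x s x * (deg x)%:R = 0.
Proof.
move=> ss; have [d [dE]] := sum_sign ss id.
move/(congr1 (fun z => 2 * z)); rewrite mulr0 mulr_sumr.
under eq_bigr => x _ do rewrite mulrCA dE mulrDr mulrA.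
have s2 x : s x * s x = 1 by case: (ss.1 x) => ->.
under eq_bigr => x _ do rewrite s2 mul1r.
by rewrite big_split /= sum_nbr_sum; move: (\sum_x _) => S; lia.
Qed.

(** Fix balanced signs off [x] and [y], and put opposite signs on [x] and [y] in both ways: the
    difference of the two instances of [sum_sign_deg] is twice [deg x - deg y]. *)
Lemma equipartite_regular (x y : G) : deg x = deg y.
Proof.
have [-> //|xy] := eqVneq x y.
have [|s s0 s1] := @balanced_signs G (~: [set x; y]).
  by have := cardsC [set x; y]; rewrite cards2 xy orderG; lia.
have sx : s x = 0 by have := s1 x; rewrite !inE eqxx.
have sy : s y = 0 by have := s1 y; rewrite !inE eqxx orbT.
have sign (c : int) : c = 1 \/ c = -1 ->
    is_sign (fun z => s z + c * dipole x y z).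
  move=> c1; split=> [z|].
    rewrite /dipole; have := s1 z; rewrite !inE.
    case: eqVneq => [->|zx] /=; first by rewrite sx (negPf xy); case: c1 => ->;
      lia.
    case: eqVneq => [->|zy] /=; first by rewrite sy; case: c1 => ->; lia.
    by rewrite mulr0 addr0.
  by rewrite big_split /= s0 (sum_dipole x y (fun=> c)) subrr.
have := sum_sign_deg (sign 1 (or_introl erefl)).
have := sum_sign_deg (sign (-1) (or_intror erefl)).
have E (c : int) : \sum_z (s z + c * dipole x y z) * (deg z)%:R =
    \sum_z s z * (deg z)%:R + ((c * (deg x)%:R) - c * (deg y)%:R).
  rewrite -(sum_dipole x y (fun z => c * (deg z)%:R)) -big_split.
  by apply: eq_bigr => z _ /=; ring.
rewrite !E; move: (\sum_z _) => S; lia.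
Qed.

(** Take [F d = d ^ 2]. With [r] the common degree and [N = nbr_sum s x], four times the summand is
    [r ^ 2 * s + 2 * r * N + s * N ^ 2]. The first two terms sum to zero, and expanding [N ^ 2] in
    the third gives the cherries centred at [x]. *)
Lemma sum_sign_cherries s : is_sign s ->
  \sum_(p : G * G * G) adjz p.1.1 p.1.2 * adjz p.1.1 p.2 *
     (s p.1.1 * s p.1.2 * s p.2) = 0.
Proof.
move=> ss.
have [r rE] : exists r : int, forall x : G, (deg x)%:R = r.
  have [x _|V0] := pickP (@predT G); last by exists 0 => x; have := V0 x.
  by exists (deg x)%:R => y; rewrite (equipartite_regular y x).
have [d [dE]] := sum_sign ss (fun k => k ^ 2)%N.
move/(congr1 (fun z => 4 * z)); rewrite mulr0 mulr_sumr.
have s2 x : s x * s x = 1 by case: (ss.1 x) => ->.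
have dE2 x : 4 * (s x * ((d x ^ 2)%N)%:R) =
   r * r * s x + 2 * r * nbr_sum s x + s x * nbr_sum s x * nbr_sum s x.
  have -> : 4 * (s x * ((d x ^ 2)%N)%:R) = s x * (2 * (d x)%:R) * (2 * (d
    x)%:R).
    by rewrite natrX; ring.
  rewrite dE rE.
  transitivity (r * r * s x + 2 * r * (s x * s x) * nbr_sum s x +
     s x * s x * s x * nbr_sum s x * nbr_sum s x); first by ring.
  by rewrite s2; ring.
under eq_bigr => x _ do rewrite dE2.
rewrite !big_split /= -!mulr_sumr ss.2 sum_nbr_sum sum_sign_deg // !mulr0
  !add0r.
move=> sum0; transitivity (\sum_x \sum_y \sum_z
    adjz x y * adjz x z * (s x * s y * s z)).
  by rewrite pair_bigA /= pair_bigA.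
rewrite -[RHS]sum0.
apply: eq_bigr => x _; rewrite /nbr_sum mulr_sumr exchange_big.
apply: eq_bigr => z _; rewrite mulr_sumr mulr_suml.
by apply: eq_bigr => y _; ring.
Qed.

Lemma sum_dipole3 (q : G -> G -> G -> int) a b c d e f :
  \sum_(p : G * G * G) q p.1.1 p.1.2 p.2 *
     (dipole a b p.1.1 * dipole c d p.1.2 * dipole e f p.2) =
  q a c e - q a c f - (q a d e - q a d f) -
  (q b c e - q b c f - (q b d e - q b d f)).
Proof.
transitivity (\sum_x \sum_y \sum_z
    q x y z * (dipole a b x * dipole c d y * dipole e f z)).
  by rewrite pair_bigA /= pair_bigA.
rewrite -!(sum_dipole e f) -!(sum_dipole c d (fun y => \sum_z _ y z * _)).
rewrite -(sum_dipole a b (fun x => \sum_y (\sum_z q x y z * _) * _)).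
apply: eq_bigr => x _; rewrite mulr_suml; apply: eq_bigr => y _.
by rewrite !mulr_suml; apply: eq_bigr => z _; ring.
Qed.

(* Polarisation of the cubic form of [sum_sign_cherries] at signs that are
   balanced separately on [a, b], on [c, d], on [e, f] and on the rest. *)
Lemma cherries_diff (a b c d e f : G) : uniq [:: a; b; c; d; e; f] ->
  let q x y z := adjz x y * adjz x z + adjz y x * adjz y z
                 + adjz z x * adjz z y in
  q a c e - q a c f - (q a d e - q a d f) -
  (q b c e - q b c f - (q b d e - q b d f)) = 0.
Proof.
move=> uS q; pose S := [set x in [:: a; b; c; d; e; f]].
have cS : #|S| = 6 by rewrite cardsE; apply/card_uniqP.
have [|s s0 s1] := @balanced_signs G (~: S).
  by have := cardsC S; rewrite cS orderG; lia.
pose t (u v w : int) x :=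
  s x + u * dipole a b x + v * dipole c d x + w * dipole e f x.
have sign u v w : u = 1 \/ u = -1 -> v = 1 \/ v = -1 -> w = 1 \/ w = -1 ->
    is_sign (t u v w).
  move=> hu hv hw; split=> [x|].
    have := s1 x; rewrite !inE /t /dipole.
    move: uS; rewrite /= !inE !negb_or -!andbA.
    case/and5P => /negPf ab /negPf ac /negPf ad /negPf ae /and5P[/negPf af].
    move=> /negPf bc /negPf bd /negPf be /and5P[/negPf bf /negPf cd /negPf ce].
    move=> /negPf cf /and4P[/negPf de /negPf df /negPf ef _].
    have [->|_] := eqVneq x a.
      by rewrite ab ac ad ae af ?eqxx /= => ->; rewrite !(subrr, mulr0, addr0);
        case: hu => ->; [left|right].
    have [->|_] := eqVneq x b.
      by rewrite bc bd be bf ?eqxx /= => ->; rewrite !(subrr, mulr0, addr0);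
        case: hu => ->; [right|left].
    have [->|_] := eqVneq x c.
      by rewrite cd ce cf ?eqxx /= => ->; rewrite !(subrr, mulr0, addr0); case:
        hv => ->; [left|right].
    have [->|_] := eqVneq x d.
      by rewrite de df ?eqxx /= => ->; rewrite !(subrr, mulr0, addr0); case: hv
        => ->; [right|left].
    have [->|_] := eqVneq x e.
      by rewrite ef ?eqxx /= => ->; rewrite !(subrr, mulr0, addr0); case: hw =>
        ->; [left|right].
    have [->|_] := eqVneq x f.
      by rewrite ?eqxx /= => ->; rewrite !(subrr, mulr0, addr0); case: hw =>
        ->; [right|left].
    by rewrite /= !mulr0 !addr0.
  rewrite !big_split /= s0 (sum_dipole a b (fun=> u)).
  by rewrite (sum_dipole c d (fun=> v)) (sum_dipole e f (fun=> w)); lia.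
pose k x y z := adjz x y * adjz x z.
pose T (g : G -> int) := \sum_(p : G * G * G) k p.1.1 p.1.2 p.2 *
  (g p.1.1 * g p.1.2 * g p.2).
have T0 u v w : u = 1 \/ u = -1 -> v = 1 \/ v = -1 -> w = 1 \/ w = -1 ->
    T (t u v w) = 0.
  by move=> hu hv hw; apply: sum_sign_cherries; apply: sign.
have one : (1 : int) = 1 \/ (1 : int) = -1 by left.
have mone : (-1 : int) = 1 \/ (-1 : int) = -1 by right.
pose D a b c d e f := \sum_(p : G * G * G) k p.1.1 p.1.2 p.2 *
     (dipole a b p.1.1 * dipole c d p.1.2 * dipole e f p.2).
(* The signed sum over the eight choices extracts the coefficient of [u * v * w]. Since [k]
   distinguishes only the centre of a cherry, the six orders of the dipoles give each of the three
   terms of [q] twice. *)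
have polar : 8 * (D a b c d e f + D a b e f c d + D c d a b e f +
     D c d e f a b + D e f a b c d + D e f c d a b) =
   T (t 1 1 1) - T (t 1 1 (-1)) - T (t 1 (-1) 1) - T (t (-1) 1 1)
   - T (t (-1) (-1) (-1)) + T (t 1 (-1) (-1)) + T (t (-1) 1 (-1))
   + T (t (-1) (-1) 1).
  rewrite /T /D -!big_split /= mulr_sumr -!sumrB -!big_split /=.
  by apply: eq_bigr => p _; rewrite /t; ring.
move: polar; rewrite !T0 // /D !sum_dipole3 /k /q.
rewrite (adjzC c a) (adjzC d a) (adjzC c b) (adjzC d b) (adjzC e a) (adjzC f a)
  (adjzC e b) (adjzC f b) (adjzC e c) (adjzC f c) (adjzC e d) (adjzC f d).
lia.
Qed.

End Signs.

Lemma sum_indicator (V : finType) (a : V) (F : V -> int) :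
  \sum_x (x == a)%:R * F x = F a.
Proof.
rewrite (bigD1 a) //= eqxx mul1r big1 ?addr0 // => x /negPf ->.
by rewrite mul0r.
Qed.

Lemma sum_off (V : finType) (s : seq V) (F : V -> int) (z : int) : uniq s ->
  (forall x, x \notin s -> F x = z) ->
  \sum_x F x = \sum_(x <- s) F x + z * (#|V|%:R - (size s)%:R).
Proof.
move=> us Fz; rewrite (bigID (mem s)) /= big_uniq //; congr (_ + _).
rewrite (eq_bigr (fun=> z)) // sumr_const -[LHS]mulr_natr; congr (_ * _).
have := cardC (mem s); rewrite (card_uniqP us) => <-.
by rewrite natrD addrC addKr; congr (_%:R); apply: eq_card => x.
Qed.

(** * Monochromatic triples of an arbitrary graph *)

Section Triangles.
Variables (G : sgraph).

Definition mono (x y z : G) : bool :=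
  [&& x != y, x != z, y != z, adj x y == adj x z & adj x y == adj y z].

Definition monoz (x y z : G) : int := (mono x y z)%:R.

Definition tri_sum (x y : G) : int := \sum_z monoz x y z.

Lemma mono_swapr x y z : mono x y z = mono x z y.
Proof.
rewrite /mono (eq_sym y z) (adj_sym z y).
case: (x != y); case: (x != z); case: (z != y); rewrite //=.
by case: (adj x y); case: (adj x z); case: (adj y z).
Qed.

Lemma mono_swapl x y z : mono x y z = mono y x z.
Proof.
rewrite /mono (eq_sym y x) (adj_sym y x).
case: (x != y); case: (x != z); case: (y != z); rewrite //=.
by case: (adj x y); case: (adj x z); case: (adj y z).
Qed.

Lemma monozC x y z : monoz x y z = monoz x z y.
Proof. by rewrite /monoz mono_swapr. Qed.

Lemma monoz_swap x y z : monoz x y z = monoz y x z.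
Proof. by rewrite /monoz mono_swapl. Qed.

Lemma monozxx x z : monoz x x z = 0.
Proof. by rewrite /monoz /mono eqxx. Qed.

Lemma monoz0 x y : (monoz x y x = 0) * (monoz x y y = 0).
Proof. by rewrite /monoz /mono !eqxx !andbF. Qed.

Lemma tri_sumC x y : tri_sum x y = tri_sum y x.
Proof. by apply: eq_bigr => z _; rewrite monoz_swap. Qed.

(** For adjacencies [p, q, r] the indicator is [pqr + (1 - p)(1 - q)(1 - r)], where the cubic terms
    cancel: what remains beyond single pairs is the number of cherries. *)
Lemma monozE x y z : x != y -> x != z -> y != z ->
  monoz x y z = 1 - (adjz x y + adjz x z + adjz y z) +
   (adjz x y * adjz x z + adjz x y * adjz y z + adjz x z * adjz y z).
Proof.
move=> xy xz yz; rewrite /monoz /mono xy xz yz /adjz.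
by case: (adj x y); case: (adj x z); case: (adj y z).
Qed.

Lemma tri_sumE x y : tri_sum x y = #|[set z | mono x y z]|%:R.
Proof. by rewrite /tri_sum -natr_sum -big_mkcond sum1_card cardsE. Qed.

End Triangles.

(** * The excess of a triple is constant *)

Section Equipartite.
Variables (n : nat) (G : sgraph).
Hypotheses (orderG : #|G| = (2 * n)%N) (equiG : degree_equipartite n G).

(** Differences along [a, b], along [c, d] and along [e, f] kill the constant and every term of
    [monozE] in a single pair, since such a term misses one of the three directions. Only the
    cherries are left. *)
Lemma monoz_diff (a b c d e f : G) : uniq [:: a; b; c; d; e; f] ->
  monoz a c e - monoz a d e - monoz b c e + monoz b d e =
  monoz a c f - monoz a d f - monoz b c f + monoz b d f.
Proof.
move=> uS; have /= := cherries_diff orderG equiG uS; move: uS.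
rewrite /= !inE !negb_or -!andbA => /and5P[ab ac ad ae /and5P[af bc bd be]].
case/and5P=> [bf cd ce cf /and4P[de df ef _]].
rewrite !monozE // => H; apply: subr0_eq; rewrite -[RHS]H.
rewrite (adjzC c a) (adjzC d a) (adjzC c b) (adjzC d b) (adjzC e a).
rewrite (adjzC f a) (adjzC e b) (adjzC f b) (adjzC e c) (adjzC f c) (adjzC e d).
by rewrite (adjzC f d); ring.
Qed.

(** Sum the second difference over its last argument. By [monoz_diff] the [2n - 4] vertices off
    [a, b, c, d] contribute equally; the contribution of [a] cancels that of [b], and the
    contribution of [c] that of [d]. *)
Lemma tri_sum_diff (a b c d e : G) : uniq [:: a; b; c; d; e] ->
  (2 * n%:R - 4) * (monoz a c e - monoz a d e - monoz b c e + monoz b d e) =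
  tri_sum a c - tri_sum a d - tri_sum b c + tri_sum b d.
Proof.
move=> uS; rewrite /tri_sum -!sumrB -big_split /=.
have u4 : uniq [:: a; b; c; d].
  by have := uS; rewrite -[[:: _; _; _; _; _]]/([:: a; b; c; d] ++ [:: e])
    cat_uniq => /and3P[].
set D := monoz a c e - _ - _ + _.
rewrite (sum_off u4 (z := D)) => [|x xS]; last first.
  have [-> //|xe] := eqVneq x e.
  apply: monoz_diff; move: uS xS xe; rewrite /= !inE !negb_or.
  by rewrite (eq_sym x a) (eq_sym x b) (eq_sym x c) (eq_sym x d)
    => /and5P[/and4P[-> -> -> ->] /and3P[-> -> ->] /andP[-> ->] -> _]
       /and4P[-> -> -> ->] ->.
rewrite !big_cons big_nil orderG !monoz0.
rewrite (monozC a c b) (monozC a d b) (monozC b c a) (monoz_swap b a c).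
rewrite (monozC b d a) (monoz_swap b a d) (monozC a d c) (monozC b d c) /=.
by rewrite natrM; ring.
Qed.

(** Because [monozE] has no cubic term, the sum involves only numbers of edges and of walks of
    length 2, which the common degree [r] determines. *)
Lemma sum_tri_sum (a b : G) : \sum_y tri_sum a y = \sum_y tri_sum b y.
Proof.
have [r rE] : exists r : int, forall x : G, \sum_y adjz x y = r.
  exists (deg a)%:R => x.
  by rewrite sum_adjz (equipartite_regular orderG equiG x a).
suff main (x : G) : \sum_y tri_sum x y =
   (#|G|%:R - 2) * (#|G|%:R - r) - 2 * r * #|G|%:R + 3 * r * r
    - (#|G|%:R - r - 2) by rewrite !main.
have constG (z : int) : \sum_(x : G) z = #|G|%:R * z.
  by rewrite sumr_const -[LHS]mulr_natl.
have C y : tri_sum x y = (#|G|%:R - 2) * (1 - adjz x y) - 2 * r +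
    2 * r * adjz x y + (\sum_z adjz x z * adjz y z)
    - (y == x)%:R * (#|G|%:R - r - 2).
  (* The polynomial of [monozE] is valid for distinct vertices; the terms with [==] correct it where
     two of them coincide. *)
  transitivity (\sum_z ((1 - adjz x y) + (adjz x y - 1) * adjz x z +
     (adjz x y - 1) * adjz y z + adjz x z * adjz y z
     + (z == y)%:R * (adjz x y - 1) + (z == x)%:R * (adjz x y - 1)
     + (y == x)%:R * (adjz x z - 1) + 2 * (y == x)%:R * (z == x)%:R)).
    rewrite /tri_sum; apply: eq_bigr => z _.
    have [->|ya] := eqVneq y x.
      rewrite monozxx !adjzxx.
      have [->|za] := eqVneq z x; first by rewrite adjzxx; lia.
      by rewrite /adjz; case: adj; lia.
    have [->|za] := eqVneq z x.
      rewrite monoz0 adjzxx (eq_sym x y) (negPf ya) (adjzC y x) /=.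
      by rewrite /adjz; case: adj; lia.
    have [->|zy] := eqVneq z y.
      by rewrite monoz0 !adjzxx /= /adjz; case: adj; lia.
    rewrite monozE // 1?eq_sym //=.
    by rewrite /adjz; case: adj; case: adj; case: adj; lia.
  rewrite !big_split /= -!mulr_sumr !sum_indicator !rE sumrB !constG rE.
  have -> : \sum_z (z == x)%:R = 1 :> int.
    rewrite -[RHS](sum_indicator x (fun=> 1)).
    by apply: eq_bigr => z _; rewrite mulr1.
  by rewrite mulr1; ring.
rewrite (eq_bigr _ (fun y _ => C y)) !big_split /= !sumrN sum_indicator.
rewrite -!mulr_sumr sumrB !constG rE.
rewrite exchange_big /=; have -> : \sum_j \sum_i adjz x j * adjz i j = r * r.
  rewrite -{1}(rE x) mulr_suml; apply: eq_bigr => z _; rewrite -mulr_sumr;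
    congr (_ * _).
  by rewrite -(rE z); apply: eq_bigr => y _; rewrite adjzC.
by ring.
Qed.

Definition tri_excess (x y z : G) : int :=
  tri_sum x y + tri_sum x z + tri_sum y z - (2 * n%:R - 4) * monoz x y z.

Lemma tri_excessC x y z : tri_excess x y z = tri_excess x z y.
Proof. by rewrite /tri_excess (monozC x z y) (tri_sumC z y); ring. Qed.

Lemma tri_excess_swap x y z : tri_excess x y z = tri_excess y x z.
Proof. by rewrite /tri_excess (monoz_swap y x z) (tri_sumC y x); ring. Qed.

(** By [tri_sum_diff] the difference [g] of the two sides does not change with [c]. Summed over all
    vertices in place of [c], with [sum_tri_sum] for the totals, everything cancels except
    [(2n - 3) * g], one summand for each vertex off [a, b, e]; and the odd number [2n - 3] is not
    zero. *)
Lemma tri_excess_replace (a b c e : G) : uniq [:: a; b; c; e] ->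
  tri_excess a c e = tri_excess b c e.
Proof.
move=> uS; have ube : uniq [:: a; b; e].
  by move: uS; rewrite /= !inE !negb_or => /and4P[/and3P[-> _ ->] /andP[_ ->]].
apply/eqP; rewrite -subr_eq0; set g := (X in X == 0).
have g_const x : x \notin [:: a; b; e] ->
    tri_excess a x e - tri_excess b x e = g.
  move=> xS; have [-> //|xc] := eqVneq x c.
  have uD : uniq [:: a; b; x; c; e].
    move: uS xS xc; rewrite /= !inE !negb_or => /and4P[/and3P[-> -> ->]].
    by case/andP=> -> -> -> _ /and3P[]; rewrite (eq_sym x a) (eq_sym x b)
      => -> -> -> ->.
  have := tri_sum_diff uD.
  by rewrite /g /tri_excess; lia.
have Cxx x : tri_sum x x = 0 by apply: big1 => z _; apply: monozxx.
have := sum_off ube g_const; rewrite !big_cons big_nil /tri_excess.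
have sum_mono x : \sum_y monoz x y e = tri_sum x e.
  by apply: eq_bigr => y _; rewrite monozC.
rewrite sumrB !big_split /= !sumrN !sumr_const -!mulr_sumr.
rewrite (sum_tri_sum a b) !sum_mono !Cxx !monozxx !monoz0 orderG.
rewrite (monoz_swap b a e) (tri_sumC b a).
rewrite -[tri_sum a e *+ _]mulr_natl -[tri_sum b e *+ _]mulr_natl natrM.
move/eqP; rewrite -subr_eq0 => /eqP E.
have {}E : g * (2 * n%:R - 3) = 0 by rewrite -[RHS]oppr0 -[in RHS]E /=; ring.
move/eqP: E; rewrite mulf_eq0 => /orP[//|]; lia.
Qed.

(* Replacing one vertex at a time leads from any triple to any other. *)
Lemma tri_excess_const (x y z x' y' z' : G) :
  uniq [:: x; y; z] -> uniq [:: x'; y'; z'] ->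
  tri_excess x y z = tri_excess x' y' z'.
Proof.
have rep a b c e : uniq [:: a; c; e] -> uniq [:: b; c; e] ->
    tri_excess a c e = tri_excess b c e.
  move=> u1 u2; have [-> //|ab] := eqVneq a b.
  apply: tri_excess_replace; move: u1 u2 ab.
  by rewrite /= !inE !negb_or => /and3P[/andP[-> ->] -> _] /and3P[/andP[-> ->]
    _ _] ->.
have perm_uniq3 (a b c : G) : uniq [:: a; b; c] ->
    uniq [:: b; a; c] /\ uniq [:: a; c; b].
  rewrite /= !inE !negb_or !andbT (eq_sym b a) (eq_sym c b).
  by case/andP=> /andP[-> ->] ->.
have to_first a : uniq [:: x; y; z] -> exists y1 z1,
    uniq [:: a; y1; z1] /\ tri_excess x y z = tri_excess a y1 z1.
  move=> u; have [ax|xa] := eqVneq x a; first by exists y, z; rewrite -ax.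
  have [ay|ya] := eqVneq y a.
    by exists x, z; rewrite tri_excess_swap -ay; split=> //; case: (perm_uniq3
      _ _ _ u).
  have [az|za] := eqVneq z a.
    exists x, y; rewrite tri_excessC tri_excess_swap -az; split=> //.
    by have [_ /perm_uniq3[]] := perm_uniq3 _ _ _ u.
  exists y, z; have ua : uniq [:: a; y; z].
    by move: u ya za; rewrite /= !inE !negb_or (eq_sym y a) (eq_sym z a)
      => /andP[_ ->] -> ->.
  by split=> //; apply: rep.
move=> u u'; have [y1 [z1 [u1 ->]]] := to_first x' u.
have [z2 [u2 ->]] : exists z2, uniq [:: x'; y'; z2] /\
    tri_excess x' y1 z1 = tri_excess x' y' z2.
  have [<-|y1y] := eqVneq y1 y'; first by exists z1.
  have [<-|z1y] := eqVneq z1 y'.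
    by exists y1; rewrite tri_excessC; split=> //; case: (perm_uniq3 _ _ _ u1).
  exists z1; have u2 : uniq [:: x'; y'; z1].
    move: u1 u' z1y; rewrite /= !inE !negb_or (eq_sym z1 y').
    by case/andP=> /andP[_ ->] _ /andP[/andP[-> _] _] ->.
  split=> //; rewrite [LHS]tri_excess_swap [RHS]tri_excess_swap.
  by apply: rep; [case: (perm_uniq3 _ _ _ u1) | case: (perm_uniq3 _ _ _ u2)].
rewrite tri_excessC tri_excess_swap [RHS]tri_excessC [RHS]tri_excess_swap.
have rot3 (a b c : G) : uniq [:: a; b; c] -> uniq [:: c; a; b].
  by move=> u3; have [_ u4] := perm_uniq3 _ _ _ u3; case: (perm_uniq3 _ _ _ u4).
by apply: rep; apply: rot3.
Qed.

End Equipartite.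

End BalancedSigns.

(** * The weights of the pairs *)

Section PairWeights.
Import Order.TTheory GRing.Theory Num.Theory.
Local Open Scope ring_scope.

Lemma exists_off (V : finType) (A : {set V}) (s : seq V) :
  (size s < #|A|)%N -> exists2 x, x \in A & x \notin s.
Proof.
move=> sA; have [sub|/subsetPn[x xA xs]] := boolP (A \subset s).
  by have := leq_trans (subset_leq_card sub) (card_size s); rewrite leqNgt sA.
by exists x.
Qed.

Lemma uniq3 (T : eqType) (x y z : T) :
  x != y -> x != z -> y != z -> uniq [:: x; y; z].
Proof. by rewrite /= !inE negb_or => -> -> ->. Qed.

Lemma uniq3P (T : eqType) (x y z : T) :
  uniq [:: x; y; z] -> [/\ x != y, x != z & y != z].
Proof. by rewrite /= !inE negb_or => /and3P[/andP[-> ->] ->]. Qed.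

(** The bound [R(3,3) <= 6], by the pigeonhole principle on the other vertices at [x]. It is applied
    to adjacency and also to the weights. *)
Lemma ramsey33 (V : finType) (f : V -> V -> bool) : (6 <= #|V|)%N ->
  exists x y z, uniq [:: x; y; z] /\ f x y = f x z /\ f x y = f y z.
Proof.
move=> V6; have [|x _ _] := @exists_off V setT [::]; first by rewrite cardsT
  (leq_trans _ V6).
have [b B3] : exists b, (2 < #|[set y | y != x & f x y == b]|)%N.
  have := cardsC1 x; rewrite -(cardsID [set y | f x y == true] [set~ x]).
  move=> S5.
  have [B3|B3] := ltnP 2 #|[set y | y != x & f x y == true]|; first by exists
    true.
  exists false; move: S5; have -> : [set~ x] :&: [set y | f x y == true] =
    [set y | y != x & f x y == true] by apply/setP => y; rewrite !inE.
  have -> : [set~ x] :\: [set y | f x y == true] =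
    [set y | y != x & f x y == false].
    by apply/setP => y; rewrite !inE andbC; case: (f x y).
  lia.
set B := [set _ | _ & _] in B3.
have [|y yB _] := @exists_off V B [::]; first by rewrite /=; lia.
have [|z zB zy] := @exists_off V B [:: y]; first by rewrite /=; lia.
have [|w wB wyz] := @exists_off V B [:: y; z]; first by rewrite /=; lia.
move: yB zB wB zy wyz; rewrite !inE !negb_or => /andP[yx /eqP fy] /andP[zx /eqP
  fz].
case/andP=> wx /eqP fw zy /andP[wy wz].
have [yz|nyz] := eqVneq (f y z) b.
  exists x, y, z; rewrite fy fz yz; split=> //.
  by apply: uniq3; rewrite // eq_sym.
have [yw|nyw] := eqVneq (f y w) b.
  exists x, y, w; rewrite fy fw yw; split=> //.
  by apply: uniq3; rewrite // eq_sym.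
have [zw|nzw] := eqVneq (f z w) b.
  exists x, z, w; rewrite fz fw zw; split=> //.
  by apply: uniq3; rewrite // eq_sym.
exists y, z, w; split; first by apply: uniq3; rewrite // eq_sym.
by move: nyz nyw nzw; case: b {B B3 fy fz fw}; case: (f y z); case: (f y w);
  case: (f z w).
Qed.

(** * Colors of pairs, and the effect of regularity *)

Section Colors.
Variable G : sgraph.

Lemma mono_colors (x y z : G) : mono x y z ->
  adj x y = adj x z /\ adj x y = adj y z.
Proof. by case/and5P=> _ _ _ /eqP xz /eqP yz. Qed.

Lemma colors_mono (x y z : G) : x != y -> x != z -> y != z ->
  adj x y = adj x z -> adj x y = adj y z -> mono x y z.
Proof. by rewrite /mono => -> -> -> <- <-; rewrite !eqxx. Qed.

Lemma mono_extend (b x y z : G) :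
  mono b x y -> mono b x z -> mono b y z -> mono x y z.
Proof.
case/and5P=> _ _ xy /eqP c1 /eqP c2 /and5P[_ _ xz /eqP c3 /eqP c4].
case/and5P=> _ _ yz /eqP c5 /eqP c6.
by apply: colors_mono; congruence.
Qed.

Lemma mono_set_color (X : {set G}) :
  (forall x y z, x \in X -> y \in X -> z \in X -> uniq [:: x; y; z] -> mono x y
    z) ->
  exists c, forall x y, x \in X -> y \in X -> x != y -> adj x y = c.
Proof.
move=> monoX.
have [/existsP[x /existsP[y /and3P[xX yX xy]]]|no] :=
  boolP [exists x, exists y, [&& x \in X, y \in X & x != y]]; last first.
  exists true => x y xX yX xy; case/existsP: no; exists x.
  by apply/existsP; exists y; rewrite xX yX.
have from_x z : z \in X -> z != x -> adj x z = adj x y.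
  move=> zX zx; have [-> //|zy] := eqVneq z y.
  have /mono_colors[//] : mono x z y.
  by apply: monoX => //; apply: uniq3; rewrite // eq_sym.
exists (adj x y) => z w zX wX zw.
have [zx|zx] := eqVneq z x; first by rewrite zx from_x // -zx eq_sym.
have [->|wx] := eqVneq w x; first by rewrite adj_sym from_x.
have /mono_colors[_ <-] : mono x z w; last by rewrite from_x.
by apply: monoX => //; apply: uniq3; rewrite // eq_sym.
Qed.

(** Color [true] means edge and [false] non-edge; arguments made for a color [c] cover a graph and
    its complement at once. *)
Definition color_deg (c : bool) (x : G) : nat :=
  #|[set y | y != x & adj x y == c]|.

Lemma color_degE c x :
  color_deg c x = (if c then deg x else #|G| - 1 - deg x)%N.
Proof.
have degE : deg x = #|[set~ x] :&: [set y | adj x y]|.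
  apply: eq_card => y; rewrite !inE.
  by case: eqVneq => [->|]; rewrite ?adj_irrefl.
case: c; rewrite degE ?subn1 -?(cardsC1 x) -?(cardsID [set y | adj x y] [set~
  x]).
  by apply: eq_card => y; rewrite !inE eqb_id.
rewrite addKn; apply: eq_card => y; rewrite !inE eqbF_neg.
by rewrite andbC.
Qed.

Hypothesis regG : forall x y : G, deg x = deg y.

Lemma color_deg_const c (x y : G) : color_deg c x = color_deg c y.
Proof. by rewrite !color_degE (regG x y). Qed.

(** The color [~~ c] is absent at [x], hence by regularity at every vertex. *)
Lemma star_const c (x : G) :
  (forall y, y != x -> adj x y = c) -> forall y z : G, y != z -> adj y z = c.
Proof.
move=> star y z yz.
have d0 : color_deg (~~ c) y = 0%N.
  rewrite (color_deg_const _ y x); apply: eq_card0 => w; rewrite !inE.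
  by apply/negP => /andP[wx]; rewrite star //; case: c {star}.
have := card0_eq d0 z; rewrite !inE (eq_sym z) yz /=.
by case: adj; case: c {star d0}.
Qed.

(** Every third vertex then forms a monochromatic triple with [x] and [y], so all pairs at [x] have
    the color of [x y]. *)
Lemma tri_sum_max (x y : G) : x != y -> #|G|%:R - 2 <= tri_sum x y ->
  exists c, forall u v : G, u != v -> adj u v = c.
Proof.
move=> xy; rewrite tri_sumE => full.
have sub : [set z | mono x y z] \subset ~: [set x; y].
  apply/subsetP => z; rewrite !inE => /and5P[_ xz yz _ _].
  by rewrite negb_or !(eq_sym z) xz.
have /eqP E : [set z | mono x y z] == ~: [set x; y].
  rewrite eqEcard sub /=; have := cardsC [set x; y]; rewrite cards2 xy /=;
    move: full; move: #|~: _| #|G| => k l; lia.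
exists (adj x y); apply: (@star_const _ x) => z zx.
have [-> //|zy] := eqVneq z y.
have : z \in ~: [set x; y] by rewrite !inE negb_or zx.
by rewrite -E inE => /mono_colors[].
Qed.

End Colors.

(** Each vertex has at most one cross pair of color [c]. In a regular graph these cross pairs are
    absent or form a perfect matching, which for the two values of [c] gives four graphs of the
    list. *)
Definition two_cliques (n : nat) (G : sgraph) : Prop :=
  exists (A : {set G}) (c : bool),
    [/\ #|A| = n,
        forall x y, x != y -> (x \in A) = (y \in A) -> adj x y = c &
        forall x y z, y != z -> (y \in A) = (z \in A) -> (x \in A) != (y \in A)
          ->
          adj x y = c -> adj x z = c -> False].

(* On each side the pairs of color [~~ c] form the 4-cycle [x z y w]. *)
Definition two_squares (G : sgraph) : Prop :=
  exists (A : {set G}) (c : bool), forall X, X = A \/ X = ~: A ->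
    exists x y z w, [/\ uniq [:: x; y; z; w], X =i [:: x; y; z; w],
      (adj x y = c /\ adj z w = c),
      (adj x z = ~~ c /\ adj x w = ~~ c) /\ (adj y z = ~~ c /\ adj y w = ~~ c) &
      forall u v, u \in X -> v \notin X -> adj u v = c].

Lemma exists3 (V : finType) (A : {set V}) (s : seq V) :
  (size s + 2 < #|A|)%N -> exists x y z, [/\ x \in A, y \in A & z \in A] /\
    uniq [:: x; y; z] /\ [/\ x \notin s, y \notin s & z \notin s].
Proof.
move=> sA; have [|x xA xs] := @exists_off V A s; first by lia.
have [|y yA] := @exists_off V A (x :: s); first by rewrite /=; lia.
have [|z zA] := @exists_off V A [:: x, y & s]; first by rewrite /=; lia.
rewrite !inE !negb_or => /and3P[zx zy zs] /andP[yx ys].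
by exists x, y, z; split=> //; split=> //; apply: uniq3; rewrite // eq_sym.
Qed.

Lemma neqP_in (T : finType) (X : {set T}) x y :
  x \in X -> y \notin X -> x != y.
Proof. by move=> xX yX; apply: contraNneq yX => <-. Qed.

Section TwoCliques.
Variables (n : nat) (G : sgraph) (A : {set G}).
Hypotheses (orderG : #|G| = (2 * n)%N) (n_ge4 : (4 <= n)%N) (cardA : #|A| = n).
Hypothesis mono_in : forall x y z, uniq [:: x; y; z] ->
  (x \in A) = (y \in A) -> (x \in A) = (z \in A) -> mono x y z.
Hypothesis mono_out : forall x y z, x != y -> (x \in A) = (y \in A) ->
  (x \in A) != (z \in A) -> ~~ mono x y z.

Lemma two_cliquesI : two_cliques n G.
Proof.
have cardC : #|~: A| = n by have := cardsC A; rewrite cardA orderG; lia.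
have [|c cA] := @mono_set_color G A.
  by move=> x y z xA yA zA u; apply: mono_in; rewrite // xA ?yA ?zA.
have [|d dA] := @mono_set_color G (~: A).
  move=> x y z; rewrite !inE => xA yA zA u.
  by apply: mono_in; rewrite // (negPf xA) ?(negPf yA) ?(negPf zA).
have cross x y z : y != z -> (y \in A) = (z \in A) -> (x \in A) != (y \in A) ->
    adj x y = adj y z -> adj x z = adj y z -> False.
  move=> yz yzA xyA e1 e2; have yxA : (y \in A) != (x \in A) by rewrite eq_sym.
  apply: (negP (mono_out yz yzA yxA)).
  have nyx : y != x by apply: contraNneq xyA => ->.
  have nzx : z != x by apply: contraNneq xyA => <-; rewrite yzA.
  by apply: colors_mono; rewrite // (adj_sym _ x) ?e1 ?e2.
suff cd : d = c.
  exists A, c; split=> // [x y xy xyA|x y z yz yzA xyA e1 e2].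
    have [xA|xA] := boolP (x \in A).
      by apply: cA; rewrite // -xyA.
    by rewrite -cd; apply: dA; rewrite // ?inE -?xyA.
  suff e3 : adj y z = c by apply: (cross x y z); rewrite ?e3.
  have [yA|yA] := boolP (y \in A); first by apply: cA; rewrite // -yzA.
  by rewrite -cd; apply: dA; rewrite // ?inE -?yzA.
have [|a1 [a2 [a3 [[A1 A2 A3] [/uniq3P[a12 a13 a23] _]]]]] :=
  @exists3 G A [::]; first by rewrite cardA (leq_trans _ n_ge4).
have [|a4 A4] := @exists_off G A [:: a1; a2; a3]; first by rewrite cardA.
rewrite !inE !negb_or => /and3P[a41 a42 a43].
have [|b1 B1 _] := @exists_off G (~: A) [::]; first by rewrite cardC (leq_trans
  _ n_ge4).
have [|b2 B2] := @exists_off G (~: A) [:: b1]; first by rewrite cardC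
  (leq_trans _ n_ge4).
rewrite inE eq_sym => b12.
have b12d : adj b1 b2 = d by apply: dA.
rewrite !inE in B1 B2.
have atmost b : b \notin A -> forall x y, x \in A -> y \in A -> x != y ->
    adj x b = c -> adj y b = c -> False.
  move=> bA x y xA yA xy; rewrite !(adj_sym _ b) => e1 e2.
  by apply: (@cross b x y); rewrite ?xA ?yA ?(negPf bA) // (cA _ _ xA yA xy).
have atmost' x : x \in A -> adj x b1 = d -> adj x b2 = d -> False.
  move=> xA e1 e2.
  by apply: (@cross x b1 b2); rewrite ?xA ?(negPf B1) ?(negPf B2) ?b12d.
have H1 := atmost b1 B1; have H2 := atmost b2 B2.
apply/eqP; apply: contraT => /eqP dc.
have {}dc : d = ~~ c by case: (d) (c) dc => [] [].
(* If the sides had different colors, each vertex of [A] would be joined in color [c] to [b1] or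
   [b2], while each of [b1], [b2] admits only one such vertex: three vertices of [A] are too
   many. *)
have T x : x \in A -> adj x b1 = c \/ adj x b2 = c.
  move=> xA; have := atmost' x xA; rewrite dc.
  by case: (adj x b1); case: (adj x b2); case: (c); auto; move=> /(_ erefl
    erefl).
rewrite eq_sym in a41; rewrite eq_sym in a42; rewrite eq_sym in a43.
have [h1|h1] := T _ A1; have [h2|h2] := T _ A2; have [h3|h3] := T _ A3;
  solve [ case: (H1 _ _ A1 A2 a12 h1 h2) | case: (H2 _ _ A1 A2 a12 h1 h2)
        | case: (H1 _ _ A1 A3 a13 h1 h3) | case: (H2 _ _ A1 A3 a13 h1 h3)
        | case: (H1 _ _ A2 A3 a23 h2 h3) | case: (H2 _ _ A2 A3 a23 h2 h3)].
Qed.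

End TwoCliques.

(** * Classification from weights 0, 1, 2 on the pairs *)

Section Weights.
Variables (n : nat) (G : sgraph) (t : G -> G -> int) (k c0 : int).
Hypotheses (orderG : #|G| = (2 * n)%N) (n_ge4 : (4 <= n)%N).
Hypothesis regG : forall x y : G, deg x = deg y.
Hypothesis c0_ge0 : 0 <= c0.
Hypothesis tC : forall x y, t x y = t y x.
Hypothesis t_range : forall x y, x != y -> t x y = 0 \/ t x y = 1 \/ t x y = 2.
Hypothesis t_tri : forall x y z, uniq [:: x; y; z] ->
  t x y + t x z + t y z = k + (if mono x y z then 2 else 0).
Hypothesis t_sum : forall x y, x != y -> tri_sum x y = c0 + (n%:R - 2) * t x y.
Hypothesis nonconst : ~ exists c, forall u v : G, u != v -> adj u v = c.

Lemma some_mixed : exists x y z : G, uniq [:: x; y; z] /\ ~~ mono x y z.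
Proof.
have [/existsP[x /existsP[y /existsP[z /andP[]]]]|no] :=
  boolP [exists x : G, exists y, exists z, uniq [:: x; y; z] && ~~ mono x y z].
  by exists x, y, z.
have [|c cP] := @mono_set_color G setT; last first.
  by case: nonconst; exists c => u v; apply: cP; rewrite inE.
move=> x y z _ _ _ u; apply: contraR no => nm.
by apply/existsP; exists x; apply/existsP; exists y; apply/existsP; exists z;
  rewrite u.
Qed.

Lemma some_mono : exists x y z : G, uniq [:: x; y; z] /\ mono x y z.
Proof.
have [|x [y [z [u [e1 e2]]]]] := @ramsey33 G (@adj G); first by rewrite orderG;
  clear -n_ge4; lia.
exists x, y, z; split=> //; have [xy xz yz] := uniq3P u.
exact: colors_mono.
Qed.

Lemma tri_sum_lt (x y : G) : x != y -> tri_sum x y < 2 * n%:R - 2.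
Proof.
move=> xy; have := @tri_sum_max G regG x y xy; rewrite orderG natrM ltNge.
by move=> H; apply/negP => /H.
Qed.

(** This is the case where one side of the cut is empty. Only [k = 4] is possible, and then a pair
    [i j] of weight 0 is the only pair at [i] of its color, as in [nK2] and its complement. *)
Lemma one_side : (forall x y, x != y -> t x y = 0 \/ t x y = 2) ->
  exists c (x : G), color_deg c x = 1%N.
Proof.
move=> t02; have [x1 [y1 [z1 [u1 m1]]]] := some_mixed.
have [x2 [y2 [z2 [u2 m2]]]] := some_mono.
have [|x3 [y3 [z3 [u3 [e3 e3']]]]] := @ramsey33 G (fun x y => t x y == 0).
  by rewrite orderG; clear -n_ge4; lia.
have T1 := t_tri u1; have T2 := t_tri u2; have T3 := t_tri u3.
have [xy1 xz1 yz1] := uniq3P u1; have [xy2 xz2 yz2] := uniq3P u2.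
have [xy3 xz3 yz3] := uniq3P u3.
rewrite (negPf m1) in T1; rewrite m2 in T2.
have range (x y z : G) : uniq [:: x; y; z] ->
    exists2 q : int, t x y + t x z + t y z = 2 * q & 0 <= q <= 3.
  case/uniq3P => xy xz yz.
  have [->|->] := t02 _ _ xy; have [->|->] := t02 _ _ xz;
    have [->|->] := t02 _ _ yz;
    by [exists 0 | exists 1 | exists 2 | exists 3].
have k04 : k = 0 \/ k = 4.
  (* The triple from [ramsey33] has three equal weights, with sum 0 or 6, whereas [k = 2] only
     allows the sums 2 and 4. *)
  have {}T3 : k <> 2.
    move: T3 e3 e3'; clear -t02 xy3 xz3 yz3.
    have [->|->] := t02 _ _ xy3; have [->|->] := t02 _ _ xz3;
      have [->|->] := t02 _ _ yz3 => //; case: mono => //; lia.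
  have [q1 E1 q1r] := range _ _ _ u1; have [q2 E2 q2r] := range _ _ _ u2.
  move: T1 T2; rewrite E1 E2; clear -T3 q1r q2r; lia.
case: k04 => k0.
  (* For [k = 0] the sums are 0 and 2, so every triple through a pair of weight 2 is monochromatic,
     against [tri_sum_lt]. *)
  have [x [y [xy txy]]] : exists x y, x != y /\ t x y = 2.
    have [] := t02 _ _ xy2; have [] := t02 _ _ xz2; have [] := t02 _ _ yz2 => a
      b c.
    - by move/eqP: T2; rewrite a b c k0.
    - by exists y2, z2.
    - by exists x2, z2.
    - by exists x2, z2.
    - by exists x2, y2.
    - by exists x2, y2.
    - by exists x2, y2.
    by exists x2, y2.
  have := tri_sum_lt xy; rewrite tri_sumE.
  have -> : [set z | mono x y z] = ~: [set x; y].
    apply/setP => z; rewrite !inE negb_or.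
    have [->|zx] := eqVneq z x; first by rewrite /mono eqxx !andbF.
    have [->|zy] := eqVneq z y; first by rewrite /mono eqxx !andbF.
    have u : uniq [:: x; y; z] by apply: uniq3; rewrite // eq_sym.
    have [_ xz yz] := uniq3P u; have /eqP := t_tri u; case: mono => //.
    by rewrite txy k0; have [->|->] := t02 _ _ xz; have [->|->] := t02 _ _ yz.
  have := cardsC [set x; y]; rewrite cards2 xy orderG /=.
  by move: #|_| => m; clear => ? ?; exfalso; lia.
(* For [k = 4] mixed triples have sum 4 and monochromatic ones sum 6, so a mixed triple contains a
   pair of weight 0. *)
have [i [j [ij tij]]] : exists i j, i != j /\ t i j = 0.
  have [] := t02 _ _ xy1; have [] := t02 _ _ xz1; have [] := t02 _ _ yz1 => a b
    c;
    try (by exists x1, y1); try (by exists x1, z1); try (by exists y1, z1).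
  by move/eqP: T1; rewrite a b c k0.
have away x : x != i -> x != j -> [/\ t i x = 2, t j x = 2 & ~~ mono i j x].
  move=> xi xj; have ix : i != x by rewrite eq_sym.
  have jx : j != x by rewrite eq_sym.
  have /eqP := t_tri (uniq3 ij ix jx); rewrite tij k0.
  by have [->|->] := t02 _ _ ix; have [->|->] := t02 _ _ jx; case: mono.
have near x y : x != i -> x != j -> y != i -> y != j -> x != y -> t x y = 2 ->
    [/\ adj i x = adj i y, adj j x = adj j y & adj i x = adj j x].
  move=> xi xj yi yj xy txy.
  have [tix tjx _] := away _ xi xj; have [tiy tjy _] := away _ yi yj.
  have ui : uniq [:: i; x; y] by apply: uniq3; rewrite // eq_sym.
  have uj : uniq [:: j; x; y] by apply: uniq3; rewrite // eq_sym.
  have /eqP := t_tri ui; have /eqP := t_tri uj.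
  rewrite tix tjx tiy tjy txy k0.
  case mj : (mono j x y) => // _; case mi : (mono i x y) => // _.
  have [a1 a2] := mono_colors mi; have [b1 b2] := mono_colors mj.
  by split; congruence.
have all_near x y : x != i -> x != j -> y != i -> y != j -> x != y ->
    adj i x = adj i y /\ adj i x = adj j x.
  move=> xi xj yi yj xy.
  have [txy|txy] := t02 _ _ xy; last by have [] := near x y xi xj yi yj xy txy.
  (* When [x y] has weight 0, a further vertex [h] has weight 2 to both [x] and [y] and links
     them. *)
  have [|h _] := @exists_off G setT [:: i; j; x; y].
    by rewrite cardsT orderG /=; clear -n_ge4; lia.
  rewrite !inE !negb_or => /and4P[hi hj hx hy].
  have uxyh : uniq [:: x; y; h] by apply: uniq3; rewrite // eq_sym.
  have [_ xh yh] := uniq3P uxyh; have /eqP := t_tri uxyh.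
  rewrite txy k0 => Th; have [txh tyh] : t x h = 2 /\ t y h = 2.
    by move: Th; have [->|->] := t02 _ _ xh; have [->|->] := t02 _ _ yh;
      case: mono.
  have [a1 _ a2] := near x h xi xj hi hj xh txh.
  have [b1 _ _] := near y h yi yj hi hj yh tyh.
  by rewrite a1 b1 -a1.
have [|x [y [_ [_ [/uniq3P[xy _ _] [xS yS _]]]]]] := @exists3 G setT [:: i; j].
  by rewrite cardsT orderG /=; clear -n_ge4; lia.
move: xS yS; rewrite !inE !negb_or => /andP[xi xj] /andP[yi yj].
exists (~~ adj i x), i; apply/eqP/cards1P; exists j; apply/setP => z; rewrite
  !inE.
have [->|zj] := eqVneq z j.
  rewrite eq_sym ij /=; have [_ _] := away _ xi xj.
  have [_ e] := all_near x y xi xj yi yj xy.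
  apply: contraNT => ne; apply: colors_mono; rewrite // 1?eq_sym // -?e //.
    by move: ne; case: adj; case: adj.
  by move: ne; case: adj; case: adj.
have [->|zi /=] := eqVneq z i; first by [].
have [->|zx] := eqVneq z x; first by case: adj.
have [-> _] := all_near z x zi zj xi xj zx; by case: adj.
Qed.


Lemma tri_sum_mixed (x y : G) : (forall z, ~~ mono x y z) -> tri_sum x y = 0.
Proof. by move=> nm; apply: big1 => z _; rewrite /monoz (negPf (nm z)). Qed.

(** Triples inside a side have sum 3: they are all mixed ([k = 3]) or all monochromatic ([k = 1]).
    Only [k = 1] with all cross weights 0 survives. *)
Lemma odd_sides (A : {set G}) : (4 <= #|A|)%N ->
  (forall x y, x != y -> (x \in A) = (y \in A) -> t x y = 1) ->
  (forall x y, (x \in A) != (y \in A) -> t x y = 0 \/ t x y = 2) ->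
  two_cliques n G.
Proof.
move=> A4 tin tout.
have [|a1 [a2 [a3 [[A1 A2 A3] [u _]]]]] := @exists3 G A [::].
  by rewrite (leq_trans _ A4).
have [|a4 A4'] := @exists_off G A [:: a1; a2; a3]; first by [].
rewrite !inE !negb_or => /and3P[a41 a42 a43].
have [a12 a13 a23] := uniq3P u.
have tin3 (x y z : G) : uniq [:: x; y; z] -> (x \in A) = (y \in A) ->
    (x \in A) = (z \in A) -> 3 = k + (if mono x y z then 2 else 0).
  move=> u3 xyA xzA; have [xy xz yz] := uniq3P u3.
  by rewrite -(t_tri u3) !tin // -xyA.
have k13 : k = 1 \/ k = 3.
  have := tin3 _ _ _ u; rewrite A1 A2 A3 => /(_ erefl erefl).
  by case: mono; clear => ?; [left | right]; lia.
have tout3 x y z : x \in A -> y \in A -> x != y -> z \notin A ->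
    1 + t x z + t y z = k + (if mono x y z then 2 else 0).
  move=> xA yA xy zA; have u3 : uniq [:: x; y; z].
    by apply: uniq3 => //; apply: contraNneq zA => <-.
  by rewrite -(t_tri u3) (tin x y) // xA yA.
have cross02 x z : x \in A -> z \notin A -> t x z = 0 \/ t x z = 2.
  by move=> xA zA; apply: tout; rewrite xA (negPf zA).
have [sub|/subsetPn[b _ bA]] := boolP ([set: G] \subset A).
  have all3 (x y z : G) : uniq [:: x; y; z] -> 3 = k + (if mono x y z then 2
    else 0).
    by move=> u3; apply: tin3; rewrite // !(subsetP sub) ?inE.
  have [x1 [y1 [z1 [u1 m1]]]] := some_mixed.
  have [x2 [y2 [z2 [u2 m2]]]] := some_mono.
  by have := all3 _ _ _ u1; have := all3 _ _ _ u2; rewrite m2 (negPf m1);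
    clear => ? ?; exfalso; lia.
case: k13 => kE; last first.
  (* For [k = 3] at most one vertex of [A] has weight 0 to [b]. Three others are pairwise
     monochromatic with [b], hence form a monochromatic triple inside [A]. *)
  exfalso.
  have nm (x y z : G) : x \in A -> y \in A -> z \in A -> uniq [:: x; y; z] ->
      ~~ mono x y z.
    move=> xA yA zA u3; have := tin3 _ _ _ u3; rewrite xA yA zA kE.
    by move=> /(_ erefl erefl) /eqP; case: mono.
  have bad (x y z : G) : x \in A -> y \in A -> z \in A -> uniq [:: x; y; z] ->
      t x b = 2 -> t y b = 2 -> t z b = 2 -> False.
    move=> xA yA zA u3 tx ty tz; have [xy xz yz] := uniq3P u3.
    apply: (negP (nm _ _ _ xA yA zA u3)).
    have m v w : v \in A -> w \in A -> v != w -> t v b = 2 -> t w b = 2 ->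
        mono b v w.
      move=> vA wA vw tv tw; have /eqP := tout3 v w b vA wA vw bA.
      by rewrite tv tw kE mono_swapr mono_swapl; case: mono.
    by apply: (mono_extend (b := b)); apply: m.
  have one x y : x \in A -> y \in A -> x != y -> t x b = 0 -> t y b = 2.
    move=> xA yA xy tx; have /eqP := tout3 x y b xA yA xy bA.
    by rewrite tx kE; have [->|-> //] := cross02 _ _ yA bA; case: mono.
  have a14 : a1 != a4 by rewrite eq_sym.
  have a24 : a2 != a4 by rewrite eq_sym.
  have a34 : a3 != a4 by rewrite eq_sym.
  have [t1|t1] := cross02 _ _ A1 bA.
    exact: (bad a2 a3 a4 A2 A3 A4' (uniq3 a23 a24 a34) (one _ _ A1 A2 a12 t1)
      (one _ _ A1 A3 a13 t1) (one _ _ A1 A4' a14 t1)).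
  have [t2|t2] := cross02 _ _ A2 bA.
    exact: (bad a1 a3 a4 A1 A3 A4' (uniq3 a13 a14 a34) t1
      (one _ _ A2 A3 a23 t2) (one _ _ A2 A4' a24 t2)).
  have [t3|t3] := cross02 _ _ A3 bA; last exact: (bad a1 a2 a3).
  exact: (bad a1 a2 a4 A1 A2 A4' (uniq3 a12 a14 a24) t1 t2
     (one _ _ A3 A4' a34 t3)).
have mono_in (x y z : G) : uniq [:: x; y; z] ->
    (x \in A) = (y \in A) -> (x \in A) = (z \in A) -> mono x y z.
  by move=> u3 xyA xzA; have /eqP := tin3 _ _ _ u3 xyA xzA; rewrite kE; case:
    mono.
(* For [k = 1], if [x z] had weight 2, two further vertices [y, w] of [A] would have weight 0 to [z]
   and be monochromatic with [x z]. Then [y w z] would be monochromatic with sum 1 instead of 3. *)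
have t0 x z : x \in A -> z \notin A -> t x z = 0.
  move=> xA zA; have [//|tx] := cross02 _ _ xA zA; exfalso.
  have other y : y \in A -> x != y -> t y z = 0 /\ mono x y z.
    move=> yA xy; have /eqP := tout3 x y z xA yA xy zA; rewrite tx kE.
    by have [->|->] := cross02 _ _ yA zA; case: mono.
  have [|y yA] := @exists_off G A [:: x]; first by rewrite (leq_trans _ A4).
  rewrite inE => yx; have [|w wA] := @exists_off G A [:: x; y].
    by rewrite (leq_trans _ A4).
  rewrite !inE negb_or => /andP[wx wy].
  have xy : x != y by rewrite eq_sym.
  have xw : x != w by rewrite eq_sym.
  have yw : y != w by rewrite eq_sym.
  have [ty my] := other y yA xy; have [tw mw] := other w wA xw.
  have := tout3 y w z yA wA yw zA; rewrite ty tw kE (mono_extend _ my mw) //.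
  by apply: mono_in; rewrite ?xA ?yA ?wA //; apply: uniq3.
have mono_out (x y z : G) : x != y -> (x \in A) = (y \in A) ->
    (x \in A) != (z \in A) -> ~~ mono x y z.
  move=> xy xyA xzA; have u3 : uniq [:: x; y; z].
    apply: uniq3 => //; first by apply: contraNneq xzA => <-.
    by apply: contraNneq xzA => <-; rewrite xyA.
  have /eqP := t_tri u3; rewrite tin // kE.
  have [xA|xA] := boolP (x \in A); move: xyA xzA.
    rewrite xA => /esym yA; case zA: (z \in A) => // _.
    by rewrite !t0 ?zA //; case: mono.
  rewrite (negPf xA) => /esym yA; case zA: (z \in A) => // _.
  by rewrite (tC x) (tC y) !t0 ?yA //; case: mono.
have tri_in : tri_sum a1 a2 = #|A|%:R - 2.
  rewrite tri_sumE; have -> : [set z | mono a1 a2 z] = A :\: [set a1; a2].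
    apply/setP => z; rewrite !inE negb_or.
    have [->|z1] := eqVneq z a1; first by rewrite /mono eqxx !andbF.
    have [->|z2] := eqVneq z a2; first by rewrite /mono eqxx !andbF.
    apply/idP/idP => [|zA].
      by apply: contraLR => zA; apply: mono_out; rewrite // A1 ?A2 // (negPf
        zA).
    by apply: mono_in; rewrite ?A1 ?A2 //; apply: uniq3; rewrite // eq_sym.
  have sub : [set a1; a2] \subset A.
    by apply/subsetP => z; rewrite !inE => /orP[] /eqP ->.
  by rewrite cardsDS // cards2 a12 natrB //; apply: leq_trans A4.
have tri_out : tri_sum a1 b = 0.
  apply: tri_sum_mixed => z; have [->|z1] := eqVneq z a1; first by rewrite
    /mono eqxx andbF.
  have [zA|zA] := boolP (z \in A).
    by rewrite mono_swapr; apply: mono_out; rewrite // 1?eq_sym // A1 ?zA //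
      (negPf bA).
  have [->|zb] := eqVneq z b; first by rewrite /mono eqxx !andbF.
  rewrite mono_swapl mono_swapr; apply: mono_out; rewrite // 1?eq_sym //.
    by rewrite (negPf bA) (negPf zA).
  by rewrite A1 (negPf bA).
apply: (@two_cliquesI n G A) => //.
(* The size of [A] follows from [t_sum]: the pair [a1 b] of weight 0 gives [c0 = 0], and the pair
   [a1 a2] of weight 1 gives [|A| - 2 = n - 2]. *)
have a1b : a1 != b by apply: contraNneq bA => <-.
have := t_sum a12; have := t_sum a1b; rewrite tri_in tri_out (t0 a1) //.
rewrite tin ?A1 ?A2 //; move: #|A| => m; clear; lia.
Qed.

(* In this case the pairs of weight 2 inside a side form a perfect matching of
   the side, which therefore has exactly four vertices. *)
Section FourSide.
Variables (X : {set G}) (e : G).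
Hypotheses (k2 : k = 2) (X4 : (4 <= #|X|)%N) (eX : e \notin X).
Hypothesis tin : forall x y, x \in X -> y \in X -> x != y -> t x y = 0 \/ t x y
  = 2.
Hypothesis tout : forall x y, x \in X -> y \notin X -> t x y = 1.

Lemma four_side_mono x y z : x \in X -> y \in X -> z \notin X -> x != y ->
  mono x y z = (t x y == 2).
Proof.
move=> xX yX zX xy; have := t_tri (uniq3 xy (neqP_in xX zX) (neqP_in yX zX)).
rewrite (tout xX zX) (tout yX zX) k2; have [->|->] := tin xX yX xy; by case:
  mono => // /eqP.
Qed.

(** The sum is 2 or 4. With sum 4 the triple is monochromatic, and two of its pairs are
    monochromatic with [e]; then so is the third pair, which therefore has weight 2 as well, a
    contradiction. *)
Lemma four_side_tri x y z : x \in X -> y \in X -> z \in X -> uniq [:: x; y; z]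
  ->
  [\/ [/\ t x y = 2, t x z = 0 & t y z = 0],
      [/\ t x y = 0, t x z = 2 & t y z = 0] |
      [/\ t x y = 0, t x z = 0 & t y z = 2]].
Proof.
move=> xX yX zX u; have [xy xz yz] := uniq3P u.
have yx : y != x by rewrite eq_sym.
have zx : z != x by rewrite eq_sym.
have zy : z != y by rewrite eq_sym.
have ext a b c : a \in X -> b \in X -> c \in X -> a != b -> a != c -> b != c ->
    t a b = 2 -> t a c = 2 -> mono a b c -> t b c = 2.
  move=> aX bX cX ab ac bc tab tac mabc; apply/eqP.
  rewrite -(four_side_mono bX cX eX bc).
  by apply: (mono_extend mabc); rewrite four_side_mono ?tab ?tac.
have := t_tri u; rewrite k2.
have := ext x y z xX yX zX xy xz yz; have := ext y x z yX xX zX yx yz xz.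
have := ext z x y zX xX yX zx zy xy.
rewrite !(tC z) (tC y x) -(mono_swapl x y z) -(mono_swapl x z y) -(mono_swapr x
  y z).
have [txy|txy] := tin xX yX xy; have [txz|txz] := tin xX zX xz;
  have [tyz|tyz] := tin yX zX yz; rewrite txy txz tyz;
  try (by move=> _ _ _ _; constructor);
  case: mono => // h1 h2 h3 /eqP // _.
all: by [move/eqP: (h1 erefl erefl isT) | move/eqP: (h2 erefl erefl isT)
  | move/eqP: (h3 erefl erefl isT)].
Qed.

Lemma four_side : exists x y z w, [/\ uniq [:: x; y; z; w], X =i [:: x; y; z;
  w],
  t x y = 2 /\ t z w = 2 &
  (t x z = 0 /\ t x w = 0) /\ (t y z = 0 /\ t y w = 0)].
Proof.
have [a [b [aX bX ab tab]]] : exists a b, [/\ a \in X, b \in X, a != b & t a b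
  = 2].
  have [|a [b [c [[aX bX cX] [u _]]]]] := @exists3 G X [::].
    by rewrite (leq_trans _ X4).
  have [ab ac bc] := uniq3P u.
  by case: (four_side_tri aX bX cX u) => [[? ? ?]|[? ? ?]|[? ? ?]];
    [exists a, b | exists a, c | exists b, c].
have [|c cX] := @exists_off G X [:: a; b]; first by rewrite (leq_trans _ X4).
rewrite !inE negb_or => /andP[ca cb].
have [|d dX] := @exists_off G X [:: a; b; c]; first by rewrite (leq_trans _ X4).
rewrite !inE !negb_or => /and3P[da db dc].
have two x y z : x \in X -> y \in X -> z \in X -> uniq [:: x; y; z] ->
    t x y = 2 -> t x z = 0 /\ t y z = 0.
  by move=> xX yX zX u txy; case: (four_side_tri xX yX zX u) => [] []; rewrite
    txy.
have apart x : x \in X -> x != a -> x != b -> t a x = 0 /\ t b x = 0.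
  by move=> xX xa xb; apply: two => //; apply: uniq3; rewrite // eq_sym.
have rest x y : x \in X -> y \in X -> x != a -> x != b -> y != a -> y != b ->
    x != y -> t x y = 2.
  move=> xX yX xa xb ya yb xy.
  have u : uniq [:: a; x; y] by apply: uniq3; rewrite // eq_sym.
  have [tax _] := apart x xX xa xb; have [tay _] := apart y yX ya yb.
  by case: (four_side_tri aX xX yX u) => [] []; rewrite tax tay.
have cd : c != d by rewrite eq_sym.
exists a, b, c, d; split; last by split; apply: conj; case: (apart c); case:
  (apart d).
- by rewrite /= !inE !negb_or ab !(eq_sym a) !(eq_sym b) ca cb da db cd.
- move=> x; apply/idP/idP; last by rewrite !inE => /or4P[] /eqP ->.
  apply: contraTT; rewrite !inE !negb_or => /and4P[xa xb xc xd].
  apply/negP => xX; have tcd := rest c d cX dX ca cb da db cd.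
  have tcx := rest c x cX xX ca cb xa xb; rewrite eq_sym in xc.
  have [|] := two c d x cX dX xX _ tcd; first by apply: uniq3; rewrite //
    eq_sym.
  by rewrite tcx.
- by split=> //; apply: rest.
Qed.

Lemma four_side_card : #|X| = 4%N.
Proof.
have [x [y [z [w [u eqX _ _]]]]] := four_side.
by rewrite (eq_card eqX) (card_uniqP u).
Qed.

(** Each [u] lies in a pair of weight 2, which is monochromatic with every outside vertex; the color
    of that pair is thus the color of all cross pairs at [u]. *)
Lemma four_side_indep u v v' : u \in X -> v \notin X -> v' \notin X ->
  adj u v = adj u v'.
Proof.
have [x [y [z [w [uS eqX [txy tzw] _]]]]] := four_side.
have inX a : a \in [:: x; y; z; w] -> a \in X by rewrite eqX.
have xX : x \in X by apply: inX; rewrite !inE eqxx.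
have yX : y \in X by apply: inX; rewrite !inE eqxx !orbT.
have zX : z \in X by apply: inX; rewrite !inE eqxx !orbT.
have wX : w \in X by apply: inX; rewrite !inE eqxx !orbT.
move: uS; rewrite /= !inE !negb_or => /and4P[/and3P[xy _ _] _ zw _].
have pair a b c : a \in X -> b \in X -> a != b -> t a b = 2 -> c \notin X ->
    adj a b = adj a c /\ adj a b = adj b c.
  by move=> aX bX ab tab cX; apply: mono_colors; rewrite four_side_mono ?tab.
rewrite eqX !inE => uX vX v'X.
have [x1 y1] := pair x y v xX yX xy txy vX.
have [x2 y2] := pair x y v' xX yX xy txy v'X.
have [z1 w1] := pair z w v zX wX zw tzw vX.
have [z2 w2] := pair z w v' zX wX zw tzw v'X.
by case/or4P: uX => /eqP ->; congruence.
Qed.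

Lemma four_side_square c : (forall u v, u \in X -> v \notin X -> adj u v = c) ->
  exists x y z w, [/\ uniq [:: x; y; z; w], X =i [:: x; y; z; w],
      (adj x y = c /\ adj z w = c),
      (adj x z = ~~ c /\ adj x w = ~~ c) /\ (adj y z = ~~ c /\ adj y w = ~~ c) &
      forall u v, u \in X -> v \notin X -> adj u v = c].
Proof.
move=> cross; have [x [y [z [w [uS eqX [txy tzw] [[txz txw] [tyz tyw]]]]]]] :=
  four_side.
have inX a : a \in [:: x; y; z; w] -> a \in X by rewrite eqX.
have xX : x \in X by apply: inX; rewrite !inE eqxx.
have yX : y \in X by apply: inX; rewrite !inE eqxx !orbT.
have zX : z \in X by apply: inX; rewrite !inE eqxx !orbT.
have wX : w \in X by apply: inX; rewrite !inE eqxx !orbT.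
move: (uS); rewrite /= !inE !negb_or => /and4P[/and3P[xy xz xw] /andP[yz yw] zw
  _].
have same a b : a \in X -> b \in X -> a != b -> t a b = 2 -> adj a b = c.
  move=> aX bX ab tab; rewrite -(cross a e aX eX).
  by have [] : adj a b = adj a e /\ adj a b = adj b e
    by apply: mono_colors; rewrite four_side_mono ?tab.
have diff a b : a \in X -> b \in X -> a != b -> t a b = 0 -> adj a b = ~~ c.
  move=> aX bX ab tab; have := four_side_mono aX bX eX ab; rewrite tab /= => nm.
  have [ab_c|] := eqVneq (adj a b) c; last by case: adj; case: (c).
  have : mono a b e.
    by apply: (colors_mono ab (neqP_in aX eX) (neqP_in bX eX));
      rewrite ab_c cross.
  by rewrite nm.
exists x, y, z, w; split=> //.
- by split; apply: same.
- by split; split; apply: diff.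
Qed.

End FourSide.

(** A pair inside [A] has sum 2 or 4 with [b], so [k] is 0, 2 or 4. For [k = 0] all pairs in [A]
    have weight 0 and are monochromatic with [b], which makes a triple of [A] monochromatic with sum
    0 instead of 2. For [k = 4] no monochromatic triple contains [a1] and [b], although [t_sum]
    gives at least [n - 2] of them. For [k = 2] both sides have four vertices. *)
Lemma even_sides (A : {set G}) (b : G) : (4 <= #|A|)%N -> b \notin A ->
  (forall x y, x != y -> (x \in A) = (y \in A) -> t x y = 0 \/ t x y = 2) ->
  (forall x y, (x \in A) != (y \in A) -> t x y = 1) ->
  two_squares G /\ n = 4%N.
Proof.
move=> A4 bA tin tout.
have [|a1 [a2 [a3 [[A1 A2 A3] [u _]]]]] := @exists3 G A [::].
  by rewrite (leq_trans _ A4).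
have [a12 a13 a23] := uniq3P u.
have tcross x y : x \in A -> y \notin A -> t x y = 1.
  by move=> xA yA; apply: tout; rewrite xA (negPf yA).
have tri_b x y : x \in A -> y \in A -> x != y ->
    t x y + 1 + 1 = k + (if mono x y b then 2 else 0).
  move=> xA yA xy; rewrite -(t_tri (uniq3 xy (neqP_in xA bA) (neqP_in yA bA))).
  by rewrite (tcross _ _ xA bA) (tcross _ _ yA bA).
have tinA x y : x \in A -> y \in A -> x != y -> t x y = 0 \/ t x y = 2.
  by move=> xA yA xy; apply: tin; rewrite // xA.
have [k0|[k2|k4]] : k = 0 \/ k = 2 \/ k = 4.
- have := tri_b _ _ A1 A2 a12; have [->|->] := tinA _ _ A1 A2 a12;
  case: mono; clear; lia.
- exfalso; have mb x y : x \in A -> y \in A -> x != y -> t x y = 0 /\ mono b x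
  y.
    move=> xA yA xy; have /eqP := tri_b _ _ xA yA xy; rewrite k0.
    have -> : mono b x y = mono x y b by rewrite mono_swapl mono_swapr.
    by have [->|->] := tinA _ _ xA yA xy; case: mono.
  have [t12 m12] := mb _ _ A1 A2 a12; have [t13 m13] := mb _ _ A1 A3 a13.
  have [t23 m23] := mb _ _ A2 A3 a23; have /eqP := t_tri u.
  by rewrite t12 t13 t23 (mono_extend m12 m13 m23) k0.
- have cardA := four_side_card k2 A4 bA tinA tcross.
  have cardC : (4 <= #|~: A|)%N.
    by have := cardsC A; rewrite cardA orderG; move: #|_| n_ge4 => m; clear;
      lia.
  have a1C : a1 \notin ~: A by rewrite inE A1.
  have tinC x y : x \in ~: A -> y \in ~: A -> x != y -> t x y = 0 \/ t x y = 2.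
    rewrite !inE => xA yA xy; apply: tin => //; by rewrite (negPf xA) (negPf
      yA).
  have tcrossC x y : x \in ~: A -> y \notin ~: A -> t x y = 1.
    by rewrite !inE negbK => xA yA; rewrite tC tcross.
  have cardC4 := four_side_card k2 cardC a1C tinC tcrossC.
  split; last by have := cardsC A; rewrite cardA cardC4 orderG; clear; lia.
  have cross x y : x \in A -> y \notin A -> adj x y = adj a1 b.
    move=> xA yA; rewrite (four_side_indep k2 A4 bA tinA tcross xA yA bA).
    rewrite !(adj_sym _ b); apply: (four_side_indep k2 cardC a1C tinC tcrossC);
      by rewrite !inE ?negbK.
  exists A, (adj a1 b) => X [->|->].
    exact: (four_side_square k2 A4 bA tinA tcross).
  apply: (four_side_square k2 cardC a1C tinC tcrossC) => x y.
  by rewrite !inE negbK => xA yA; rewrite adj_sym cross.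
exfalso.
have nmb x y z : x \in A -> y \in A -> x != y -> z \notin A ->
    t x y = 2 /\ ~~ mono x y z.
  move=> xA yA xy zA.
  have /eqP := t_tri (uniq3 xy (neqP_in xA zA) (neqP_in yA zA)).
  rewrite (tcross _ _ xA zA) (tcross _ _ yA zA) k4.
  by have [->|->] := tinA _ _ xA yA xy; case: mono.
have nma z : ~~ mono a1 b z.
  have [->|z1] := eqVneq z a1; first by rewrite /mono eqxx andbF.
  have [->|zb] := eqVneq z b; first by rewrite /mono eqxx !andbF.
  have [zA|zA] := boolP (z \in A).
    by rewrite mono_swapr; have [|_ ->] := nmb a1 z b A1 zA _ bA; rewrite //
      eq_sym.
  have u' : uniq [:: a1; b; z].
    by apply: uniq3; rewrite ?(neqP_in A1) // eq_sym.
  have bz : b != z by rewrite eq_sym.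
  have bzA : (b \in A) = (z \in A) by rewrite (negPf bA) (negPf zA).
  have /eqP := t_tri u'; rewrite k4 (tcross _ _ A1 bA) (tcross _ _ A1 zA).
  by have [->|->] := tin _ _ bz bzA; case: mono.
have := t_sum (neqP_in A1 bA); rewrite (tri_sum_mixed nma) tcross //.
by move: c0_ge0 n_ge4; clear; lia.
Qed.

(** For even [k] the weights are even inside the sides and 1 across; for odd [k] it is the other way
    round. *)
Lemma sides_classification (A : {set G}) : (4 <= #|A|)%N ->
  (forall x y, x != y ->
     ((t x y - k) %% 2)%Z = if (x \in A) == (y \in A) then 0 else 1) ->
  (exists c (x : G), color_deg c x = 1%N) \/ two_cliques n G \/
  (two_squares G /\ n = 4%N).
Proof.
move=> A4 par.
have neq x y : (x \in A) != (y \in A) -> x != y by apply: contraNneq => ->.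
have [keven|kodd] : (k %% 2)%Z = 0 \/ (k %% 2)%Z = 1 by clear; lia.
  have tin x y : x != y -> (x \in A) = (y \in A) -> t x y = 0 \/ t x y = 2.
    move=> xy xyA; have := par x y xy; rewrite xyA eqxx; have := t_range xy.
    move: keven; clear; lia.
  have tout x y : (x \in A) != (y \in A) -> t x y = 1.
    move=> xyA; have := par x y (neq x y xyA); rewrite (negPf xyA).
    have := t_range (neq x y xyA); move: keven; clear; lia.
  have [sub|/subsetPn[b _ bA]] := boolP ([set: G] \subset A).
    left; apply: one_side => x y xy; apply: tin => //.
    by rewrite !(subsetP sub) ?inE.
  by right; right; apply: (even_sides A4 bA).
right; left; apply: (odd_sides A4) => x y => [xy xyA|xyA].
  have := par x y xy; rewrite xyA eqxx; have := t_range xy.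
  move: kodd; clear; lia.
have := par x y (neq x y xyA); rewrite (negPf xyA).
have := t_range (neq x y xyA); move: kodd; clear; lia.
Qed.

(* Every triple has [t]-sum of the parity of [k], so [t - k] is a cut. *)
Lemma weights_classification :
  (exists c (x : G), color_deg c x = 1%N) \/ two_cliques n G \/
  (two_squares G /\ n = 4%N).
Proof.
have [|x0 _ _] := @exists_off G setT [::].
  by rewrite cardsT orderG muln_gt0 (leq_trans _ n_ge4).
pose A := [set y | (y == x0) || (((t x0 y - k) %% 2)%Z == 0)].
have x0A : x0 \in A by rewrite inE eqxx.
have A0 y : x0 != y -> ((t x0 y - k) %% 2)%Z = if y \in A then 0 else 1.
  by rewrite eq_sym inE => /negPf -> /=; case: eqP => //; clear; lia.
have par x y : x != y ->
    ((t x y - k) %% 2)%Z = if (x \in A) == (y \in A) then 0 else 1.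
  move=> xy; have [xE|xx0] := eqVneq x0 x.
    by move: xy; rewrite -xE => /A0 ->; rewrite x0A.
  have [yE|yx0] := eqVneq x0 y.
    by move: xy; rewrite -yE eq_sym => /A0; rewrite tC x0A => ->; case: (x \in
      A).
  have := t_tri (uniq3 xx0 yx0 xy); have := A0 x xx0; have := A0 y yx0.
  case: (x \in A); case: (y \in A); case: mono => /=; clear; lia.
have [A4|A4] := leqP 4 #|A|; first exact: (sides_classification A4 par).
apply: (@sides_classification (~: A)) => [|x y xy].
  by have := cardsC A; rewrite orderG; move: #|~: _| #|_| A4 n_ge4 => a b;
    clear; lia.
by rewrite par // !in_setC; case: (x \in A); case: (y \in A).
Qed.

End Weights.

(** * Construction of the weights for [n >= 4] *)

Section Classification.
Variables (n : nat) (G : sgraph).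
Hypotheses (orderG : #|G| = (2 * n)%N) (equiG : degree_equipartite n G).

(** In the excesses of [x y z] and [x y w] minus those of [x z w] and [y z w], only [x y] and [z w]
    survive, each twice; halving turns the factor [2n - 4] into [n - 2]. *)
Lemma tri_sum_step (x y z w : G) : uniq [:: x; y; z; w] ->
  tri_sum x y - tri_sum z w =
  (n%:R - 2) * (monoz x y z + monoz x y w - monoz x z w - monoz y z w).
Proof.
rewrite /= !inE !negb_or => /and4P[/and3P[xy xz xw] /andP[yz yw] zw _].
have E := tri_excess_const orderG equiG.
have := E _ _ _ _ _ _ (uniq3 xy xz yz) (uniq3 xz xw zw).
have := E _ _ _ _ _ _ (uniq3 xy xw yw) (uniq3 yz yw zw).
rewrite /tri_excess.
move: (tri_sum x y) (tri_sum x z) (tri_sum y z) (tri_sum x w) (tri_sum y w).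
move: (tri_sum z w) (monoz x y z) (monoz x y w) (monoz x z w) (monoz y z w).
clear=> *; nia.
Qed.

Lemma large_classification : (4 <= n)%N ->
  (exists c, forall u v : G, u != v -> adj u v = c) \/
  (exists c (x : G), color_deg c x = 1%N) \/ two_cliques n G \/
  (two_squares G /\ n = 4%N).
Proof.
move=> n4; have regG := equipartite_regular orderG equiG.
have [/existsP[c /forallP const]|nconst] :=
  boolP [exists c, forall u : G, forall v, (u != v) ==> (adj u v == c)].
  by left; exists c => u v uv; have /forallP/(_ v) := const u; rewrite uv =>
    /eqP.
have nonconst : ~ exists c, forall u v : G, u != v -> adj u v = c.
  case=> c cP; case/existsP: nconst; exists c; apply/forallP => u.
  by apply/forallP => v; apply/implyP => uv; rewrite cP.
right.
have off (s : seq G) : (size s <= 4)%N -> exists x y, uniq [:: x; y] /\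
    x \notin s /\ y \notin s.
  move=> s4; have [|x [y [z [_ [/uniq3P[xy _ _] [xs ys _]]]]]] := @exists3 G
    setT s.
    by rewrite cardsT orderG; move: s4 n4; move: (size s) => m; clear; lia.
  by exists x, y; rewrite /= inE xy.
have [//|a [b [uab _]]] := off [::].
have ab : a != b by move: uab; rewrite /= inE andbT.
(* A pair minimising [tri_sum] serves as base, so that no weight is negative. *)
case: (arg_minnP (P := fun p : G * G => p.1 != p.2)
  (fun p => #|[set z | mono p.1 p.2 z]|) (ab : (a, b).1 != (a, b).2)).
case=> x0 y0 /= xy0 minxy.
pose c0 := tri_sum x0 y0; pose t (x y : G) := ((tri_sum x y - c0) %/ (n%:R -
  2))%Z.
have n2 : n%:R - 2 != 0 :> int by move: n4; clear; lia.
have t_sum x y : x != y -> tri_sum x y = c0 + (n%:R - 2) * t x y.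
  (* [tri_sum_step] compares disjoint pairs; a pair [z w] disjoint from both [x y] and [x0 y0]
     mediates between them. *)
  move=> xy; have [//|z [w [uzw [zS wS]]]] := off [:: x; y; x0; y0].
  have zw : z != w by move: uzw; rewrite /= inE andbT.
  move: zS wS; rewrite !inE !negb_or.
  case/and4P=> zx zy zx0 zy0 /and4P[wx wy wx0 wy0].
  have u1 : uniq [:: x; y; z; w].
    by rewrite /= !inE !negb_or xy zw !(eq_sym _ z) !(eq_sym _ w) zx zy wx wy.
  have u2 : uniq [:: z; w; x0; y0].
    by rewrite /= !inE !negb_or zw xy0 zx0 zy0 wx0 wy0.
  have [q E] : exists q : int, tri_sum x y - c0 = (n%:R - 2) * q.
    have := tri_sum_step u1; have := tri_sum_step u2.
    set q1 := (X in _ = _ * X) => E1; set q2 := (X in _ = _ * X) => E2.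
    by exists (q2 + q1); rewrite mulrDr -E1 -E2 addrA subrK.
  by rewrite /t E mulKz // -E addrC subrK.
have c0_ge0 : 0 <= c0 by rewrite /c0 tri_sumE ler0n.
have t_range x y : x != y -> t x y = 0 \/ t x y = 1 \/ t x y = 2.
  move=> xy; have := tri_sum_lt orderG regG nonconst xy.
  have := minxy (x, y) xy; rewrite /= -(ler_nat int) -!tri_sumE -/c0 t_sum //.
  move: (t x y) c0_ge0 n4; set c := c0; move: c; clear=> c s *; nia.
have [|x1 [y1 [z1 [_ [u1 _]]]]] := @exists3 G setT [::].
  by rewrite cardsT orderG /=; move: n4; clear; lia.
(* Any one triple can define [k]: the constant excess, divided by [n - 2], says that the sum of
   weights minus [2 m] is the same for all triples. *)
apply: (@weights_classification n G t
  (t x1 y1 + t x1 z1 + t y1 z1 - (if mono x1 y1 z1 then 2 else 0)) c0) => //.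
  by move=> x y; rewrite /t tri_sumC.
move=> x y z u; apply/eqP; rewrite -subr_eq0; apply/eqP/(mulfI n2).
have := tri_excess_const orderG equiG u u1; rewrite /tri_excess /monoz.
have [xy xz yz] := uniq3P u; have [xy1 xz1 yz1] := uniq3P u1.
rewrite !t_sum // mulr0.
have -> (m : bool) : (if m then 2 else 0) = 2 * m%:R :> int by case: m.
have -> (m : bool) : (if m then 2 else 0) = 2 * m%:R :> int by case: m.
move=> /eqP; rewrite -subr_eq0 => /eqP E; rewrite -[RHS]E; ring.
Qed.

End Classification.

End PairWeights.

(** * Small orders *)

Section SmallCases.
Variables (n : nat) (G : sgraph).
Hypotheses (orderG : #|G| = 2 * n) (equiG : degree_equipartite n G).

Let regG := equipartite_regular orderG equiG.

Lemma color_deg_le1 c (x : G) : color_deg c x <= 1 ->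
  (exists c, forall u v : G, u != v -> adj u v = c) \/
  (exists c (x : G), color_deg c x = 1).
Proof.
case d0: (color_deg c x) => [|[|//]] _; last by right; exists c, x.
left; exists (~~ c); apply: (@star_const G regG _ x) => y yx.
have := card0_eq d0 y; rewrite !inE yx /=.
by case: adj; case: (c).
Qed.

Lemma color_degC c (x : G) : color_deg c x + color_deg (~~ c) x = 2 * n - 1.
Proof.
rewrite -orderG subn1 -(cardsC1 x) -(cardsID [set y | adj x y == c] [set~ x]).
by congr (_ + _); apply: eq_card => y; rewrite !inE // andbC;
  case: adj; case: (c).
Qed.

(** At a vertex the two color degrees add up to at most 3, so one of them is at most 1. *)
Lemma tiny_classification : n <= 2 ->
  (exists c, forall u v : G, u != v -> adj u v = c) \/
  (exists c (x : G), color_deg c x = 1).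
Proof.
move=> n2; have [x _|V0] := pickP (@predT G); last first.
  by left; exists true => u; have := V0 u.
have [d1|d1] := leqP (color_deg true x) 1; first exact: color_deg_le1 d1.
apply: (@color_deg_le1 false x); have := color_degC true x.
by move: (color_deg _ _) (color_deg _ _) d1 n2; clear; lia.
Qed.

(** A monochromatic triple [A] exists by [ramsey33], and equal degree sequences make its complement
    monochromatic of the same color. These are the two sides. *)
Lemma triple_classification : n = 3 ->
  (exists c, forall u v : G, u != v -> adj u v = c) \/
  (exists c (x : G), color_deg c x = 1) \/ two_cliques n G.
Proof.
move=> n3; have [|x [y [z [u [exz eyz]]]]] := @ramsey33 G (@adj G).
  by rewrite orderG n3.
have [xy xz yz] := uniq3P u.
pose A := [set x; y; z]; pose c := adj x y.
have cardA : #|A| = 3 by rewrite /A -setUA cardsU1 !inE negb_or xy xz cards2 yz.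
have cardC : #|~: A| = 3 by have := cardsC A; rewrite cardA orderG n3; clear;
  lia.
have cA a b : a \in A -> b \in A -> a != b -> adj a b = c.
  have xyc : adj x y = c by [].
  have xzc : adj x z = c by rewrite -exz.
  have yzc : adj y z = c by rewrite -eyz.
  rewrite !inE -!orbA.
  by case/or3P=> /eqP -> /or3P[] /eqP ->; rewrite ?eqxx // => _; rewrite //
    adj_sym.
clearbody A c.
(* The indicator of the degree that every vertex of [A] has: its sum 3 on [A] forces the value 1 at
   all three vertices of the complement. *)
pose F d := if d == (if c then 2 else 0) then 1 else 0.
have sumA : \sum_(a in A) F (deg_in A a) = 3.
  rewrite -[RHS]cardA -sum1_card; apply: eq_bigr => a aA; rewrite /F.
  suff -> : deg_in A a = if c then 2 else 0 by rewrite eqxx.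
  have -> : deg_in A a = #|if c then A :\ a else set0|.
    apply: eq_card => b; case cE: c; rewrite !in_set ?in_set1.
      have [->|ba] := eqVneq b a; first by rewrite adj_irrefl andbF.
      by case bA: (b \in A); rewrite //= (cA a b) // eq_sym.
    case bA: (b \in A) => //=; have [->|ba] := eqVneq b a; first by rewrite
      adj_irrefl.
    by rewrite (cA a b) // eq_sym.
  by case: (c); rewrite ?cards0 // -[RHS]/3.-1 -cardA (cardsD1 a A) aA.
have degB b : b \in ~: A -> deg_in (~: A) b = if c then 2 else 0.
  move=> bC; apply/eqP; apply: contraT => nb.
  have := (degree_equipartiteP n G).1 equiG A; rewrite cardA n3 => /(_ erefl F).
  rewrite sumA (bigD1 b) //= {1}/F (negPf nb) add0n => E.
  have : \sum_(i in ~: A | i != b) F (deg_in (~: A) i) <= #|~: A :\ b|.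
    rewrite -sum1_card [X in _ <= X](eq_bigl (fun i => (i \in ~: A) && (i !=
      b))).
      by apply: leq_sum => i _; rewrite /F; case: ifP.
    by move=> i; rewrite in_setD1 andbC.
  by rewrite -E; have := cardsD1 b (~: A); rewrite bC cardC; case: #|_| =>
    [|[|[|]]].
have cB a b : a \in ~: A -> b \in ~: A -> a != b -> adj a b = c.
  move=> aC bC ab; have := degB a aC; case cE: c => d.
    have /eqP E : [set y in ~: A | adj a y] == ~: A :\ a.
      rewrite eqEcard; apply/andP; split.
        apply/subsetP => v; rewrite in_set in_setD1 => /andP[-> av]; rewrite
          andbT.
        by apply: contraTneq av => ->; rewrite adj_irrefl.
      rewrite -[#|[set _ in _ | _]|]/(deg_in (~: A) a) d.
      by have := cardsD1 a (~: A); rewrite aC cardC; case: #|_| => [|[|[|]]].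
    by have := in_setD1 b (~: A) a; rewrite -E in_set bC eq_sym ab.
  by have := card0_eq d b; rewrite in_set bC.
have same a b : (a \in A) = (b \in A) -> a != b -> adj a b = c.
  case aA: (a \in A) => bA ab; first by apply: cA.
  by apply: cB; rewrite // in_setC ?aA -?bA.
(* A vertex [p] with two cross pairs of color [c] has at most one pair of color [~~ c], as the other
   side has three vertices; without such a vertex, [two_cliques] holds. *)
have [/existsP[p /existsP[v /existsP[w /and5P[vw vwA pv e1 e2]]]]|no] :=
  boolP [exists p : G, exists v : G, exists w : G, [&& v != w, (v \in A) == (w
    \in A),
     (p \in A) != (v \in A), adj p v == c & adj p w == c]].
  have [] : _ \/ _ := @color_deg_le1 (~~ c) p _; last 2 first.
  - by left.
  - by right; left.
  pose B := if p \in A then ~: A else A.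
  have cardB : #|B| = 3 by rewrite /B; case: ifP.
  have inB q : (q \in B) = ((p \in A) != (q \in A)).
    by rewrite /B; case: ifP => _; rewrite ?in_setC //; case: (q \in A).
  have vB : v \in B by rewrite inB.
  have wB : w \in B by rewrite inB -(eqP vwA).
  suff sub : [set q | q != p & adj p q == ~~ c] \subset B :\: [set v; w].
    apply: leq_trans (subset_leq_card sub) _.
    rewrite cardsDS ?cardB ?cards2 ?vw //.
    by apply/subsetP => q; rewrite !inE => /orP[] /eqP ->.
  apply/subsetP => q; rewrite !inE => /andP[qp /eqP qc].
  have -> : q \in B.
    rewrite inB; apply: contraT; rewrite negbK => /eqP pq.
    by move: qc; rewrite same // 1?eq_sym //; case: (c).
  rewrite andbT negb_or; apply/andP; split.
    by apply: contraTneq e1 => <-; rewrite qc; case: (c).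
  by apply: contraTneq e2 => <-; rewrite qc; case: (c).
right; right; exists A, c; split; first by rewrite cardA.
  by move=> a b ab abA; apply: same.
move=> p v w vw vwA pv e1 e2; case/existsP: no; exists p.
apply/existsP; exists v; apply/existsP; exists w.
by apply/and5P; split=> //; apply/eqP.
Qed.

Lemma equipartite_classification :
  (exists c, forall u v : G, u != v -> adj u v = c) \/
  (exists c (x : G), color_deg c x = 1) \/ two_cliques n G \/
  (two_squares G /\ n = 4).
Proof.
have [n2|n3] := leqP n 2.
  by have [|] := tiny_classification n2; [left | right; left].
have [n4|n4] := leqP 4 n; first exact: large_classification.
have /triple_classification : n = 3 by move: n3 n4; clear; lia.
by case=> [|[]]; [left | right; left | right; right; left].
Qed.

End SmallCases.

(** * The graphs of the list *)

(* The graphs on two rows in which adjacency only depends on whether the rows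
   and the columns agree: all graphs of the list, up to isomorphism, except
   2C_4 and its complement. *)
Section Grid.
Variables (n : nat) (al be ga : bool).

Definition grid_adj : rel ('I_2 * 'I_n)%type := fun u v =>
  if u.1 == v.1 then (u.2 != v.2) && al else if u.2 == v.2 then be else ga.

Lemma grid_sym : symmetric grid_adj.
Proof. by move=> u v; rewrite /grid_adj !(eq_sym u.1, eq_sym u.2). Qed.

Lemma grid_irrefl : irreflexive grid_adj.
Proof. by move=> u; rewrite /grid_adj !eqxx. Qed.

Definition grid : sgraph := SGraph grid_sym grid_irrefl.

End Grid.

Lemma isomorphic_const (G H : sgraph) c : #|G| = #|H| ->
  (forall u v : G, u != v -> adj u v = c) ->
  (forall u v : H, u != v -> adj u v = c) -> isomorphic G H.
Proof.
move=> GH cG cH.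
have bf : bijective (fun x : G => enum_val (cast_ord GH (enum_rank x)) : H).
  exists (fun y : H => enum_val (cast_ord (esym GH) (enum_rank y))) => x;
    by rewrite enum_valK (cast_ordK, cast_ordKV) enum_rankK.
exists (fun x : G => enum_val (cast_ord GH (enum_rank x)) : H) => // x y.
have [->|xy] := eqVneq x y; first by rewrite !adj_irrefl.
by rewrite cG ?cH // (inj_eq (bij_inj bf)).
Qed.

Lemma isomorphic_empty n (G : sgraph) : #|G| = 2 * n ->
  (forall u v : G, u != v -> adj u v = false) -> isomorphic G (empty_graph n).
Proof.
move=> oG cG; apply: (@isomorphic_const _ _ false) => //.
  by rewrite oG card_prod !card_ord muln1.
move=> [i a] [j b]; rewrite (ord1 a) (ord1 b) /= /copies_adj /= /complete_adj.
by rewrite eqxx andbF.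
Qed.

Lemma isomorphic_complete n (G : sgraph) : #|G| = 2 * n ->
  (forall u v : G, u != v -> adj u v = true) -> isomorphic G (K2n n).
Proof.
move=> oG cG; apply: (@isomorphic_const _ _ true) => //.
by rewrite oG card_ord.
Qed.

Lemma swap_bij n : bijective (fun u : 'I_2 * 'I_n => (u.2, u.1)).
Proof. by exists (fun v => (v.2, v.1)) => [[]|[]]. Qed.

Lemma id_bij (T : Type) : bijective (fun x : T => x).
Proof. by exists id. Qed.

Lemma grid_nK2 n : isomorphic (grid n false true false) (nK2 n).
Proof.
exists (fun u : grid n false true false => (u.2, u.1) : nK2 n).
  exact: swap_bij.
move=> [i a] [j b] /=; rewrite /copies_adj /grid_adj /= /complete_adj.
by case: (i == j); case: (a == b).
Qed.

Lemma grid_K2n_minus_nK2 n :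
  isomorphic (grid n true false true) (K2n_minus_nK2 n).
Proof.
exists (fun u : grid n true false true => (u.2, u.1) : K2n_minus_nK2 n).
  exact: swap_bij.
move=> [i a] [j b] /=; rewrite /del_adj /= /copies_adj /grid_adj /=
  /complete_adj.
by rewrite xpair_eqE; case: (i == j); case: (a == b).
Qed.

Lemma grid_Knn_minus_nK2 n :
  isomorphic (grid n false false true) (Knn_minus_nK2 n).
Proof.
exists id; first exact: id_bij.
move=> [i a] [j b] /=; rewrite /del_adj /= /Knn_adj /matching_adj /grid_adj /=.
by case: (i == j); case: (a == b).
Qed.

Lemma grid_two_Kn n : isomorphic (grid n true false false) (two_Kn n).
Proof.
exists id; first exact: id_bij.
move=> [i a] [j b] /=; rewrite /copies_adj /grid_adj /= /complete_adj.
by case: (i == j); case: (a == b).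
Qed.

Lemma grid_two_Kn_plus_nK2 n :
  isomorphic (grid n true true false) (two_Kn_plus_nK2 n).
Proof.
exists id; first exact: id_bij.
move=> [i a] [j b] /=; rewrite /add_adj /= /copies_adj /matching_adj /grid_adj.
by rewrite /= /complete_adj; case: (i == j); case: (a == b).
Qed.

Lemma grid_Knn n : isomorphic (grid n false true true) (Knn n).
Proof.
exists id; first exact: id_bij.
move=> [i a] [j b] /=; rewrite /grid_adj /Knn_adj /=.
by case: (i == j); case: (a == b).
Qed.

Lemma ord2P (P : 'I_2 -> Prop) : P ord0 -> P ord_max -> forall i, P i.
Proof.
by move=> P0 P1 [[|[|//]] i]; [move: P0 | move: P1];
  congr P; apply: val_inj.
Qed.

Lemma sum_pair_in (I J : finType) (B : {set I * J}) (H : I * J -> nat) :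
  \sum_(x in B) H x = \sum_i \sum_j if (i, j) \in B then H (i, j) else 0.
Proof. by rewrite big_mkcond pair_bigA; apply: eq_bigr => -[]. Qed.

(** As [|A| = n], passing to the complement exchanges the two row counts, and the columns inside [A]
    are as many as those that avoid [A]. So the vertices of row [i] in the complement have the same
    degrees as those of the opposite row in [A]. *)
Lemma grid_equipartite n al be ga : degree_equipartite n (grid n al be ga).
Proof.
apply/degree_equipartiteP => A cA F.
have cCA : #|~: A| = n.
  by have := cardsC A; rewrite cA card_prod !card_ord; lia.
pose row (B : {set grid n al be ga}) i := \sum_(c < n) ((i, c) \in B).
pose opp (i : 'I_2) := rev_ord i.
pose both (B : {set grid n al be ga}) :=
  \sum_(c < n) ((ord0, c) \in B) * ((ord_max, c) \in B).
(* The degree of a vertex of [B] in row [i], where [b] tells whether its partner is in [B]: [- 1]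
   discards the vertex itself and [- b] the partner. *)
pose phi B i (b : bool) :=
  al * (row B i - 1) + be * b + ga * (row B (opp i) - b).
have opp0 : opp ord0 = ord_max by apply: val_inj.
have opp1 : opp ord_max = ord0 by apply: val_inj.
have oppK i : opp (opp i) = i by apply: rev_ordK.
have opp_neq i : (i == opp i) = false by move: i; apply: ord2P.
have rowD1 B i c : row B i = ((i, c) \in B) + \sum_(d < n | d != c) ((i, d) \in
  B).
  by rewrite /row (bigD1 c).
have sum2 (H : 'I_2 -> nat) i : \sum_j H j = H i + H (opp i).
  rewrite big_ord_recl big_ord1; have -> : lift ord0 ord0 = ord_max :> 'I_2.
    exact: val_inj.
  by move: i; apply: ord2P; rewrite ?opp0 ?opp1 // addnC.
have card_rows (B : {set grid n al be ga}) : #|B| = row B ord0 + row B ord_max.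
  rewrite -sum1_card sum_pair_in.
  by rewrite (sum2 _ ord0) opp0; congr (_ + _); apply: eq_bigr => c _; case:
    ifP.
have degE (B : {set grid n al be ga}) i c : (i, c) \in B ->
    deg_in B (i, c) = phi B i ((opp i, c) \in B).
  move=> icB; rewrite /deg_in -sum1_card sum_pair_in.
  rewrite (sum2 _ i) /phi -addnA; congr (_ + _).
    rewrite (rowD1 B i c) icB addKn (bigD1 c) //= inE /= /grid_adj /= !eqxx
      andbF add0n.
    rewrite big_distrr; apply: eq_bigr => d dc /=.
    by rewrite inE /= /grid_adj /= eqxx eq_sym dc; case: (_ \in B); case: (al).
  rewrite (rowD1 B (opp i) c) addKn (bigD1 c) //= inE /= /grid_adj /= eqxx
    opp_neq.
  congr (_ + _); first by case: (_ \in B); case: (be).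
  rewrite big_distrr; apply: eq_bigr => d dc /=.
  by rewrite inE /= /grid_adj /= opp_neq eq_sym (negPf dc); case: (_ \in B);
    case: (ga).
have sumE (B : {set grid n al be ga}) : \sum_(x in B) F (deg_in B x) =
    \sum_i (both B * F (phi B i true) + (row B i - both B) * F (phi B i false)).
  rewrite sum_pair_in.
  apply: eq_bigr => i _ /=.
  have bothE : both B = \sum_(c < n) ((i, c) \in B) * ((opp i, c) \in B).
    move: i; apply: ord2P; rewrite ?opp0 ?opp1 //.
    by apply: eq_bigr => c _; rewrite mulnC.
  have restE : row B i - both B = \sum_(c < n) ((i, c) \in B) * ((opp i, c)
    \notin B).
    apply/eqP; rewrite -(eqn_add2l (both B)) subnKC bothE.
      rewrite -big_split; apply/eqP; apply: eq_bigr => c _ /=.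
      by case: (_ \in B); case: (_ \in B).
    by apply: leq_sum => c _; case: (_ \in B); case: (_ \in B).
  rewrite restE bothE !big_distrl -big_split; apply: eq_bigr => c _ /=.
  case: ifP => icB; last by [].
  by rewrite degE //; case: (_ \in B); rewrite ?mul1n ?mul0n ?addn0.
have rowC i : row (~: A) i = row A (opp i).
  have rA := card_rows A; rewrite cA in rA.
  have : row A i + row (~: A) i = n.
    rewrite -big_split /= -[RHS]card_ord -sum1_card; apply: eq_bigr => c _.
    by rewrite in_setC; case: (_ \in A).
  by move: i rA; apply: ord2P; rewrite ?opp0 ?opp1; lia.
have bothC : both (~: A) = both A.
  have rA := card_rows A; rewrite cA in rA.
  suff : both (~: A) + (row A ord0 + row A ord_max) = both A + n.
    by rewrite -rA; lia.
  rewrite -[n in RHS]card_ord -[in RHS]sum1_card -!big_split.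
  apply: eq_bigr => c _ /=; rewrite !in_setC.
  by case: (_ \in A); case: (_ \in A).
have phiC i b : phi (~: A) i b = phi A (opp i) b by rewrite /phi !rowC oppK.
rewrite !sumE !(sum2 _ ord0) !opp0 bothC !phiC !rowC !opp0 !opp1.
exact: addnC.
Qed.

(** The 4-cycle is complete bipartite between even and odd vertices. *)
Lemma C4_adjE (x y : C4) : adj x y = odd (x + y).
Proof. by case: x => [[|[|[|[|//]]]] ?]; case: y => [[|[|[|[|//]]]] ?]. Qed.

Lemma two_C4_equipartite : degree_equipartite 4 two_C4.
Proof.
apply/degree_equipartiteP => A cA F.
have sum2 (H : 'I_2 -> nat) : \sum_i H i = H ord0 + H ord_max.
  rewrite big_ord_recl big_ord1; congr (_ + H _); exact: val_inj.
pose o0 := @Ordinal 4 0 isT; pose o1 := @Ordinal 4 1 isT.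
pose o2 := @Ordinal 4 2 isT; pose o3 := @Ordinal 4 3 isT.
have sum4 (H : 'I_4 -> nat) : \sum_i H i = H o0 + H o1 + H o2 + H o3.
  rewrite !big_ord_recl big_ord0 addn0 !addnA.
  by congr (H _ + H _ + H _ + H _); apply: val_inj.
pose m (B : {set two_C4}) i j : bool := (i, j) \in B.
have ord4P (P : 'I_4 -> Prop) : P o0 -> P o1 -> P o2 -> P o3 -> forall j, P j.
  by move=> P0 P1 P2 P3 [[|[|[|[|//]]]] i];
    [move: P0 | move: P1 | move: P2 | move: P3]; congr P; apply: val_inj.
have s0 : ordS o0 = o1 by apply: val_inj.
have s1 : ordS o1 = o2 by apply: val_inj.
have s2 : ordS o2 = o3 by apply: val_inj.
have s3 : ordS o3 = o0 by apply: val_inj.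
have p0 : ord_pred o0 = o3 by apply: val_inj.
have p1 : ord_pred o1 = o0 by apply: val_inj.
have p2 : ord_pred o2 = o1 by apply: val_inj.
have p3 : ord_pred o3 = o2 by apply: val_inj.
have b2b (x : bool) : (if x then 1 else 0) = x by case: x.
have degE (B : {set two_C4}) i j : deg_in B (i, j) =
    m B i (ordS j) + m B i (ord_pred j).
  rewrite /deg_in -sum1_card sum_pair_in sum2 !sum4 !inE /= /copies_adj.
  rewrite !C4_adjE -!/(m B _ _) [fst _]/= [snd _]/=.
  have n01 : (ord0 == ord_max :> 'I_2) = false by [].
  have n10 : (ord_max == ord0 :> 'I_2) = false by [].
  move: i j; apply: ord2P; apply: ord4P;
    rewrite !(s0, s1, s2, s3, p0, p1, p2, p3) /= ?eqxx ?n01 ?n10 /= ?andbF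
      ?andbT
      !b2b ?add0n ?addn0 //; exact: addnC.
have sumE (B : {set two_C4}) : \sum_(x in B) F (deg_in B x) =
  \sum_i \sum_j (if m B i j then F (m B i (ordS j) + m B i (ord_pred j)) else
    0).
  rewrite sum_pair_in; apply: eq_bigr => i _; apply: eq_bigr => j _.
  by rewrite degE.
have cardE : \sum_i \sum_j m A i j = 4.
  rewrite -cA -sum1_card sum_pair_in; apply: eq_bigr => i _.
  by apply: eq_bigr => j _; rewrite /m; case: ifP.
have mC i j : m (~: A) i j = ~~ m A i j by rewrite /m in_setC.
rewrite !sumE.
transitivity (\sum_i \sum_j (if ~~ m A i j
    then F (~~ m A i (ordS j) + ~~ m A i (ord_pred j)) else 0)); last first.
  by apply: eq_bigr => i _; apply: eq_bigr => j _; rewrite !mC.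
move: cardE; rewrite !sum2 !sum4 !(s0, s1, s2, s3, p0, p1, p2, p3).
(* A check of all [2 ^ 8] sets; those not of size 4 contradict [cardE], and in the others the two
   sums have the same terms. *)
move: (m A) => a; case: (a ord0 o0); case: (a ord0 o1); case: (a ord0 o2);
case: (a ord0 o3); case: (a ord_max o0); case: (a ord_max o1);
case: (a ord_max o2); case: (a ord_max o3) => //= _; rewrite ?addn0 ?add0n;
  ring.
Qed.

(** * Recognising the graphs of the list *)

Section GridIsomorphisms.
Variables (n : nat) (G : sgraph).
Hypothesis orderG : #|G| = 2 * n.

(** The involution [f] supplies the columns: the column of [x] is the position in [A] of whichever
    of [x] and [f x] lies in [A]. *)
Lemma isomorphic_grid (A : {set G}) (f : G -> G) al be ga : #|A| = n ->
  (forall x, f (f x) = x) -> (forall x, (f x \in A) = (x \notin A)) ->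
  (forall x y, x != y -> adj x y =
     if (x \in A) == (y \in A) then al else if f x == y then be else ga) ->
  isomorphic G (grid n al be ga).
Proof.
move=> cardA fK fA adjG.
(* The order 0 is treated apart because [inord] needs a nonempty ordinal type. *)
case: n orderG cardA => [oG _|m oG cardA].
  apply: (@isomorphic_const _ _ true) => [|u|[i []] //].
    by rewrite oG card_prod !card_ord.
  by have := fintype0 u; rewrite oG.
pose base x := if x \in A then x else f x.
have baseA x : base x \in A by rewrite /base; case: ifP => // xA; rewrite fA xA.
pose rank x : 'I_m.+1 := inord (index (base x) (enum A)).
have rankE x y : (rank x == rank y) = (base x == base y).
  rewrite -val_eqE /= !inordK -?cardA ?[#|A|]cardE ?index_mem ?mem_enum //.
  apply/eqP/eqP => [|-> //].
  by apply: index_inj; rewrite ?mem_enum.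
pose g x : grid m.+1 al be ga := (if x \in A then ord0 else ord_max, rank x).
have gsideE x y : ((g x).1 == (g y).1) = ((x \in A) == (y \in A)).
  by rewrite /g /=; case: (x \in A); case: (y \in A).
have gI : injective g.
  move=> x y gxy; have := gsideE x y; rewrite gxy eqxx => /esym/eqP xyA.
  have := rankE x y; rewrite -[rank x]/(g x).2 -[rank y]/(g y).2 gxy eqxx.
  move=> /esym/eqP; rewrite /base xyA; case: ifP => // _ fxy.
  by rewrite -(fK x) fxy fK.
exists g; first by apply: inj_card_bij => //; rewrite oG card_prod !card_ord.
move=> x y; have [->|xy] := eqVneq x y; first by rewrite !adj_irrefl.
rewrite [LHS]/(grid_adj al be ga _ _) /grid_adj gsideE [(g x).2 == _]rankE adjG
  //.
rewrite /base; case: eqP => xyA.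
  rewrite -xyA; suff -> : ((if x \in A then x else f x) == (if x \in A then y
    else f y)) = (x == y).
    by rewrite xy.
  by case: ifP => // _; apply/eqP/eqP => [fxy|-> //]; rewrite -(fK x) fxy fK.
suff -> : ((if x \in A then x else f x) == (if y \in A then y else f y)) = (f x
  == y) by [].
move: xyA; case: (x \in A); case: (y \in A) => // _.
by apply/eqP/eqP => [->|<-]; rewrite fK.
Qed.

Lemma color_deg1_grid c (x : G) : (forall u v : G, deg u = deg v) ->
  color_deg c x = 1 -> isomorphic G (grid n (~~ c) c (~~ c)).
Proof.
move=> regG d1; have {}d1 (u : G) : color_deg c u = 1.
  by rewrite (color_deg_const regG c u x).
pose f (u : G) := odflt u [pick v | (v != u) && (adj u v == c)].
have fP u v : ((v != u) && (adj u v == c)) = (v == f u).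
  have /eqP/cards1P[w wE] := d1 u.
  have S v' : ((v' != u) && (adj u v' == c)) = (v' == w).
    by have := in_set1 v' w; rewrite -wE in_set.
  rewrite S /f; case: pickP => [w'|/(_ w)]; rewrite S ?eqxx //.
  by move=> /eqP ->.
have fK u : f (f u) = u.
  have := fP u (f u); rewrite eqxx => /andP[fu e].
  by apply/esym/eqP; rewrite -fP eq_sym fu adj_sym.
have fneq u : f u != u by have := fP u (f u); rewrite eqxx => /andP[].
(* One vertex from each matched pair. Any choice works, since here the first and third grid
   parameters agree. *)
pose A := [set u | enum_rank u < enum_rank (f u)].
have fA u : (f u \in A) = (u \notin A).
  rewrite !inE fK -leqNgt ltn_neqAle val_eqE (inj_eq enum_rank_inj).
  by rewrite fneq.
have cardA : #|A| = n.
  have fI : injective f by apply: can_inj fK.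
  have E : f @^-1: A = ~: A by apply/setP => u; rewrite in_setC -fA inE.
  have := cardsC A; rewrite -E on_card_preimset.
    by rewrite orderG; lia.
  by exists f => u _.
apply: (isomorphic_grid cardA fK fA) => u v uv.
have := fP u v; rewrite eq_sym uv /= (eq_sym v) => E.
have -> : (if (u \in A) == (v \in A) then ~~ c else if f u == v then c else ~~
  c)
   = if f u == v then c else ~~ c.
  case: (f u =P v) => [<-|_]; last by case: ifP.
  by rewrite fA; case: (u \in A).
by rewrite -E; case: adj; case: (c).
Qed.

(** An arbitrary pairing of the sides is enough for [isomorphic_grid] when all cross pairs have one
    color. *)
Lemma exchange_sides (A : {set G}) : #|A| = n ->
  exists f : G -> G, (forall x, f (f x) = x) /\ (forall x, (f x \in A) = (x
    \notin A)).
Proof.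
move=> cardA; have cardC : #|~: A| = n.
  by have := cardsC A; rewrite cardA orderG; lia.
pose move_to (B C : {set G}) x := nth x (enum C) (index x (enum B)).
have moveC (B C : {set G}) x : #|B| = n -> #|C| = n -> x \in B ->
    move_to B C x \in C /\ move_to C B (move_to B C x) = x.
  move=> cB cC xB; have ix : index x (enum B) < size (enum C).
    by rewrite -cardE cC -cB cardE index_mem mem_enum.
  split; first by rewrite -mem_enum mem_nth.
  rewrite /move_to index_uniq ?enum_uniq //.
  by rewrite (set_nth_default x) ?nth_index ?mem_enum // index_mem mem_enum.
pose f x := if x \in A then move_to A (~: A) x else move_to (~: A) A x.
have fA x : (f x \in A) = (x \notin A).
  rewrite /f; case: ifP => xA.
    have [] := moveC A (~: A) x cardA cardC xA.
    by rewrite in_setC => /negPf.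
  by have [] := moveC (~: A) A x cardC cardA; rewrite ?in_setC ?xA.
exists f; split=> // x; have := fA x; rewrite /f.
case xA: (x \in A) => /= ->.
  by have [] := moveC A (~: A) x cardA cardC xA.
by have [] := moveC (~: A) A x cardC cardA; rewrite ?in_setC ?xA.
Qed.

(** The color degree for [c] is [n - 1] plus the number, 0 or 1, of cross pairs of color [c] at the
    vertex. By regularity this number is the same everywhere, and if it is 1 the cross pairs define
    the involution. *)
Lemma two_cliques_grid : (forall u v : G, deg u = deg v) -> two_cliques n G ->
  exists c, isomorphic G (grid n c (~~ c) (~~ c)) \/
            isomorphic G (grid n c c (~~ c)).
Proof.
move=> regG [A [c [cardA inside across]]]; exists c.
have cardC : #|~: A| = n by have := cardsC A; rewrite cardA orderG; lia.
pose cross (x : G) := [set y | ((y \in A) != (x \in A)) && (adj x y == c)].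
have cross1 x y z : y \in cross x -> z \in cross x -> y = z.
  rewrite !inE => /andP[yA /eqP e1] /andP[zA /eqP e2].
  apply/eqP; apply: contraT => yz; exfalso.
  apply: (across x y z yz) => //; last by rewrite eq_sym.
  by move: yA zA; case: (y \in A); case: (z \in A); case: (x \in A).
have degE (x : G) : color_deg c x = n - 1 + #|cross x|.
  rewrite /color_deg -(cardsID [set y | (y \in A) == (x \in A)]); congr (_ + _).
    pose B := if x \in A then A else ~: A.
    have xB : x \in B by rewrite /B; case: ifP => // xA; rewrite in_setC xA.
    have -> : n = #|B| by rewrite /B; case: ifP.
    rewrite (cardsD1 x B) xB addKn; apply: eq_card => y; rewrite !inE.
    have -> : (y \in B) = ((y \in A) == (x \in A)).
      by rewrite /B; case: ifP => _; rewrite ?in_setC; case: (y \in A).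
    have [->|yx] /= := eqVneq y x; first by [].
    case yA: ((y \in A) == (x \in A)); rewrite ?andbF //= andbT.
    apply/eqP; apply: inside.
      by rewrite eq_sym.
    by rewrite (eqP yA).
  apply: eq_card => y; rewrite !inE; have [->|] := eqVneq y x; first by rewrite
    eqxx.
  by [].
have [/existsP[x /existsP[y xy]]|none] := boolP [exists x, exists y, y \in
  cross x].
  right; have all1 u : exists v, v \in cross u.
    apply/set0Pn; rewrite -card_gt0.
    have := color_deg_const regG c u x; rewrite !degE => /addnI ->.
    by rewrite card_gt0; apply/set0Pn; exists y.
  pose f (u : G) := odflt u [pick v in cross u].
  have fP u v : (v \in cross u) = (f u == v).
    rewrite /f; case: pickP => [w wu|no]; last by have [w] := all1 u; rewrite
      no.
    by apply/idP/eqP => [|<- //]; apply: cross1.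
  have crossC u v : (v \in cross u) = (u \in cross v).
    by rewrite !inE eq_sym adj_sym.
  have fK u : f (f u) = u by apply/eqP; rewrite -fP crossC fP.
  have fA u : (f u \in A) = (u \notin A).
    have : f u \in cross u by rewrite fP.
    by rewrite inE => /andP[]; case: (f u \in A); case: (u \in A).
  apply: (isomorphic_grid cardA fK fA) => u v uv; case: eqP => uvA.
    exact: inside.
  rewrite -fP inE; move: uvA; case: (u \in A); case: (v \in A) => //= _;
    by case: adj; case: (c).
left; have [f [fK fA]] := exchange_sides cardA.
apply: (isomorphic_grid cardA fK fA) => u v uv; case: eqP => uvA.
  exact: inside.
rewrite if_same; have : v \notin cross u.
  by apply: contra none => vu; apply/existsP; exists u; apply/existsP; exists v.
by rewrite inE; move: uvA; case: (u \in A); case: (v \in A) => //= _;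
  case: adj; case: (c).
Qed.

End GridIsomorphisms.

Lemma two_squares_iso (G : sgraph) (A : {set G}) : #|G| = 8 ->
  (forall X, X = A \/ X = ~: A ->
    exists x y z w, [/\ uniq [:: x; y; z; w], X =i [:: x; y; z; w],
      (adj x y = false /\ adj z w = false),
      (adj x z = true /\ adj x w = true) /\ (adj y z = true /\ adj y w = true) &
      forall u v, u \in X -> v \notin X -> adj u v = false]) ->
  isomorphic G two_C4.
Proof.
move=> oG sq; apply: isomorphic_sym.
have [|x [y [z [w [u1 eqA [xy zw] [[xz xw] [yz yw]] cross]]]]] := sq A; first
  by left.
have [|x' [y' [z' [w' [u2 eqC [xy' zw'] [[xz' xw'] [yz' yw']] _]]]]] := sq (~:
  A).
  by right.
(* The non-adjacent pairs [x y] and [z w] must be opposite on the cycle, hence the order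
   [x, z, y, w]. *)
pose row (i : 'I_2) := if i == ord0 then [:: x; z; y; w] else [:: x'; z'; y';
  w'].
pose g (u : two_C4) : G := nth x (row u.1) u.2.
have rowA i j : (g (i, j) \in A) = (i == ord0).
  move: i; apply: ord2P; rewrite /g /=; case: j => [[|[|[|[|//]]]] ?] /=;
    first [ by rewrite eqA !inE eqxx ?orbT
          | by apply/negbTE; rewrite -in_setC eqC !inE eqxx ?orbT].
have row_uniq i : uniq (row i).
  have sw (a b c d : G) : uniq [:: a; b; c; d] -> uniq [:: a; c; b; d].
    rewrite /= !inE !negb_or (eq_sym c b).
    by case/and4P=> /and3P[-> -> ->] /andP[-> ->] -> _.
  by move: i; apply: ord2P; rewrite /row /=; apply: sw.
have gI : injective g.
  move=> [i j] [i' j'] e; have := rowA i j; rewrite e rowA => ii.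
  have {ii}ii : i' = i.
    move: i i' ii {e}; apply: ord2P; apply: ord2P => //.
  move: e; rewrite ii /g /= => /eqP; rewrite nth_uniq //.
  - by move=> /eqP jj; congr (_, _); apply: val_inj.
  - by move: (ltn_ord j); rewrite /row; case: eqP.
  - by move: (ltn_ord j'); rewrite /row; case: eqP.
exists g; first by apply: inj_card_bij => //; rewrite oG card_prod !card_ord.
move=> [i j] [i' j']; rewrite [RHS]/(_ && _) [fst _]/= [snd _]/=.
rewrite C4_adjE; have [<-|ii] := eqVneq i i'.
  move: i; apply: ord2P; rewrite /g /=.
    case: j => [[|[|[|[|//]]]] ?]; case: j' => [[|[|[|[|//]]]] ?] //=;
      by rewrite ?adj_irrefl // adj_sym.
  case: j => [[|[|[|[|//]]]] ?]; case: j' => [[|[|[|[|//]]]] ?] //=;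
    by rewrite ?adj_irrefl // adj_sym.
have := rowA i j; have := rowA i' j'.
have [i0|i0] := eqVneq i ord0.
  move: ii; rewrite i0 eq_sym => /negPf -> gA gB.
  by rewrite cross ?gB // gA.
have -> : (i' == ord0) = true.
  by move: i i' ii i0; apply: ord2P => // ; apply: ord2P.
by move=> gA gB; rewrite adj_sym cross // gB.
Qed.

Lemma two_squares_isomorphic (G : sgraph) : #|G| = 8 -> two_squares G ->
  isomorphic G two_C4 \/ isomorphic G K8_minus_2C4.
Proof.
move=> oG [A [[] sq]]; [right | left]; last exact: (two_squares_iso oG sq).
apply: isomorphic_trans (compl_compl G) _.
apply: isomorphic_trans _ compl_two_C4; apply: isomorphic_compl.
apply: (@two_squares_iso (compl G) A oG) => X /sq.
case=> x [y [z [w [uS eqX [xy zw] [[xz xw] [yz yw]] cross]]]].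
have flip (u v : G) c : u != v -> adj u v = c -> compl_adj u v = ~~ c.
  by rewrite /compl_adj => -> ->.
move: (uS); rewrite /= !inE !negb_or.
case/and4P=> /and3P[nxy nxz nxw] /andP[nyz nyw] nzw _.
exists x, y, z, w; split=> //.
- by split; apply: (@flip _ _ true).
- by split; split; apply: (@flip _ _ false).
move=> u v uX vX; apply: (@flip _ _ true); last exact: cross.
exact: neqP_in uX vX.
Qed.

Lemma equipartite_of_grid n (G : sgraph) al be ga :
  isomorphic (grid n al be ga) G -> degree_equipartite n G.
Proof.
by move=> iso; apply: (degree_equipartite_iso iso); apply: grid_equipartite.
Qed.

Lemma grid_const n c (u v : grid n c c c) : u != v -> adj u v = c.
Proof.
case: u v => [i a] [j b]; rewrite xpair_eqE /= /grid_adj /=.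
by case: (i == j); case: (a == b).
Qed.

Lemma card_grid n al be ga : #|grid n al be ga| = 2 * n.
Proof. by rewrite card_prod !card_ord. Qed.

Theorem theorem10 (n : nat) (G : sgraph) (orderG : #|G| = 2 * n) :
  degree_equipartite n G <->
  (isomorphic G (empty_graph n) \/
   isomorphic G (nK2 n) \/
   isomorphic G two_C4 \/
   isomorphic G (Knn_minus_nK2 n) \/
   isomorphic G (two_Kn n)) \/
  (isomorphic G (K2n n) \/
   isomorphic G (K2n_minus_nK2 n) \/
   isomorphic G K8_minus_2C4 \/
   isomorphic G (two_Kn_plus_nK2 n) \/
   isomorphic G (Knn n)).
Proof.
split=> [equiG|].
  have regG := equipartite_regular orderG equiG.
  have [[[] const]|[[c [x d1]]|[cl|[sq n4]]]] :=
    equipartite_classification orderG equiG.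
  - by right; left; apply: isomorphic_complete.
  - by left; left; apply: isomorphic_empty.
  - have := color_deg1_grid orderG regG d1; case: c d1 => _ iso.
      by left; right; left; apply: isomorphic_trans iso (grid_nK2 n).
    by right; right; left; apply: isomorphic_trans iso (grid_K2n_minus_nK2 n).
  - have [[] []] := two_cliques_grid orderG regG cl => iso.
    + left; right; right; right; right.
      exact: isomorphic_trans iso (grid_two_Kn n).
    + right; right; right; right; left.
      exact: isomorphic_trans iso (grid_two_Kn_plus_nK2 n).
    + right; right; right; right; right.
      exact: isomorphic_trans iso (grid_Knn n).
    left; right; right; right; left.
    exact: isomorphic_trans iso (grid_Knn_minus_nK2 n).
  have oG : #|G| = 8 by rewrite orderG n4.
  have [] := two_squares_isomorphic oG sq => iso.
    by left; right; right; left.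
  by right; right; right; left.
have from_grid H al be ga : isomorphic (grid n al be ga) H -> isomorphic G H ->
    degree_equipartite n G.
  move=> gH GH; apply: (@equipartite_of_grid n G al be ga).
  exact: isomorphic_trans gH (isomorphic_sym GH).
have n4 H : isomorphic G H -> #|H| = 8 -> n = 4.
  by case=> f bf _ oH; have := bij_eq_card bf; rewrite orderG oH; lia.
case=> [[GH|[GH|[GH|[GH|GH]]]]|[GH|[GH|[GH|[GH|GH]]]]].
(* The edgeless graph, like the complete one below, is a grid with three equal parameters. *)
- by apply: from_grid GH; apply: isomorphic_empty (card_grid _ _ _ _)
  (@grid_const _ false).
- exact: from_grid (grid_nK2 n) GH.
- rewrite (n4 _ GH); last by rewrite card_prod !card_ord.
  exact: (degree_equipartite_iso (isomorphic_sym GH) two_C4_equipartite).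
- exact: from_grid (grid_Knn_minus_nK2 n) GH.
- exact: from_grid (grid_two_Kn n) GH.
- by apply: from_grid GH; apply: isomorphic_complete (card_grid _ _ _ _)
  (@grid_const _ true).
- exact: from_grid (grid_K2n_minus_nK2 n) GH.
- have card8 : #|K8_minus_2C4| = 8 by rewrite card_prod !card_ord.
  rewrite (n4 _ GH) //; apply: (degree_equipartite_iso (isomorphic_sym GH)).
  apply: (degree_equipartite_iso compl_two_C4).
  apply: degree_equipartite_compl two_C4_equipartite.
  by rewrite card_prod !card_ord.
- exact: from_grid (grid_two_Kn_plus_nK2 n) GH.
- exact: from_grid (grid_Knn n) GH.
Qed.
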